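(* Let $(e_i)_{i\ge1}$ be a sequence of natural numbers such that $E=\bigcup_{i\ge1}\{e_i\}$ is taut. For $i\ge1$ let $\mathcal{P}_i$ be the set of all primes in the arithmetic progression $2^{i+1}\mathbb{Z}+2^i+1$. Then there exist $K_i\in\mathbb{N}$, $i\ge1$, such that for all Behrend sets $A_i\subseteq\mathcal{P}_i\cap[K_i,\infty)$, $i\ge1$ (for example $A_i=\mathcal{P}_i\cap[K_i,\infty)$), the set $B=\bigcup_{i\ge1}e_iA_i$ is Besicovitch and $B'=E$.
   Context: $\mathbb{N}=\{1,2,\dots\}$. For $c\in\mathbb{N}$ and $A\subseteq\mathbb{N}$, $cA=\{ca:a\in A\}$. For $B\subseteq\mathbb{N}$ let $\mathcal{M}_B=\bigcup_{b\in B}b\mathbb{Z}$. For $A\subseteq\mathbb{Z}$, the natural density is $d(A)=\lim_{n\to\infty}\frac1n|A\cap[1,n]|$ (if it exists) and the logarithmic density is $\delta(A)=\lim_{n\to\infty}\frac{1}{\ln n}\sum_{1\le k\le n,\,k\in A}\frac1k$; $\delta(\mathcal{M}_B)$ exists for every $B\subseteq\mathbb{N}$ (Davenport--Erdős). $B$ is Besicovitch if $d(\mathcal{M}_B)$ exists. $B$ is taut if $\delta(\mathcal{M}_{B\setminus\{b\}})<\delta(\mathcal{M}_B)$ for every $b\in B$. $B$ is Behrend if $B\subseteq\mathbb{N}\setminus\{1\}$ and $\delta(\mathcal{M}_B)=1$. $B^{prim}=B\setminus\bigcup_{k\ge2}kB$. Tautification: put $C(B)=\{c\in\mathbb{N}: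 cA\subseteq B\text{ for some Behrend set }A\}$; the tautification of $B$ is $B'=(B\cup C(B))^{prim}$. (Equivalently, $B'$ is the unique taut set whose Mirsky measure equals that of $B$, where the Mirsky measure of $B$ is the shift-invariant measure on $\{0,1\}^{\mathbb{Z}}$ for which $\mathbf{1}_{\mathbb{Z}\setminus\mathcal{M}_B}$ is quasi-generic along any sequence realizing the lower density of $\mathcal{M}_B$.) *)

(* Defs.v *)
From HB Require Import structures.
From mathcomp Require Import all_boot all_order all_algebra.
From mathcomp Require Import all_classical all_reals all_analysis.

Set Implicit Arguments.
Unset Strict Implicit.
Unset Printing Implicit Defensive.

Import Order.TTheory GRing.Theory Num.Theory.
Import numFieldNormedType.Exports.

Local Open Scope classical_set_scope.
Local Open Scope ring_scope.

(* Sets of positive integers are encoded as [set nat]; positivity is required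
   explicitly wherever a number is introduced. *)

Definition dilate (c : nat) (A : set nat) : set nat :=
  [set (c * a)%N | a in A].

Definition multiples (B : set nat) : set int :=
  \bigcup_(b in B) [set z : int | (b%:Z %| z)%Z].

Definition natural_average (R : realType) (A : set int) (n : nat) : R :=
  (count (fun k : nat => k%:Z \in A) (iota 1 n))%:R / n%:R.

Definition log_average (R : realType) (A : set int) (n : nat) : R :=
  (\sum_(1 <= k < n.+1 | k%:Z \in A) k%:R^-1) / ln n%:R.

(* [limn] returns a default value on divergent sequences; [log_density] is only
   used at [A = multiples B], where the limit exists by the Davenport-Erdos
   theorem. *)
Definition log_density (R : realType) (A : set int) : R :=
  limn (log_average R A).

Definition besicovitch (R : realType) (B : set nat) : Prop :=
  cvgn (natural_average R (multiples B)).

Definition taut (R : realType) (B : set nat) : Prop :=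
  forall b : nat, B b ->
    log_density R (multiples (B `\ b)) < log_density R (multiples B).

Definition behrend (R : realType) (B : set nat) : Prop :=
  B `<=` [set n | (1 < n)%N] /\ log_density R (multiples B) = 1.

Definition primitive_part (B : set nat) : set nat :=
  B `\` \bigcup_(k in [set k | (2 <= k)%N]) dilate k B.

Definition behrend_quotients (R : realType) (B : set nat) : set nat :=
  [set c | (0 < c)%N /\ exists2 A, behrend R A & dilate c A `<=` B].

Definition tautification (R : realType) (B : set nat) : set nat :=
  primitive_part (B `|` behrend_quotients R B).

Definition progression_primes (i : nat) : set nat :=
  [set p | prime p /\ p = 2 ^ i + 1 %[mod 2 ^ i.+1]].

(* Main.v *)
(** Put K_i = e_1 ... e_i.  The multiples of e_i divisible by none of e_1, ..., e_{i-1}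
    form a K_i-periodic set of density d_i, so at most 2 d_i n of them lie in [1, n] when
    n >= K_i.  Multiples of e_i A_i start above K_i and the sum of the d_i converges,
    so the density of the multiples of B is the limit of the densities of the multiples
    of e_1, ..., e_k.

    A set A of integers > 1 is Behrend iff finite subsets of A have multiples of density
    arbitrarily close to 1.  For the nontrivial direction, apply Harris' correlation
    inequality on Z/Q to the two divisor-closed conditions "free from S" and "gcd with Q
    at most x": the sum of 1/n over the n <= x free from S is at least the density of
    that set times the harmonic sum.  The same inequality shows that one of two sets
    with Behrend union is Behrend.  Hence if c A is contained in B with A Behrend and no
    e_i divides c, then for some g the set of the e_i / g with gcd (e_i, c) = g is
    Behrend, contradicting tautness.

    That the primes p = 1 + 2d mod 4d, d = 2^j, have divergent reciprocal sum is proved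
    by counting in Z[z], z^d = -1.  All points of a suitable residue class have norm
    1 + 2d mod 4d and coprime to the small primes, so each lies in a prime ideal above
    some p which is not 1 mod 4d, of norm p if p is in the progression and at least p^2
    otherwise.  An ideal of norm w contains O(Y^d / w + 1) points of a box of side Y,
    because distinct points cannot be too close; if the reciprocals had a finite sum,
    summing over p would not account for the whole box. *)

Require Import Defs.
From mathcomp Require Import all_boot all_order all_algebra.
From mathcomp Require Import all_solvable all_field.
From mathcomp Require Import all_classical all_reals all_analysis.
From mathcomp Require Import zify ring lra.

Set Implicit Arguments.
Unset Strict Implicit.
Unset Printing Implicit Defensive.

Import Order.TTheory GRing.Theory Num.Theory.
Import numFieldNormedType.Exports.

Local Open Scope ring_scope.

(** * A norm form on integer polynomials *)

(* [half_norm a] is the polynomial [b] with [b(X^2) = a(X) a(-X)]; descending the tower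
   of quadratic extensions, [tower_norm j a] is the norm of [a(z)], where [z] is a
   primitive [2^(j+1)]-th root of unity. *)
Definition half_norm (a : {poly int}) : {poly int} :=
  even_poly a ^+ 2 - 'X * odd_poly a ^+ 2.

Fixpoint tower_norm (j : nat) (a : {poly int}) : int :=
  if j is j'.+1 then tower_norm j' (half_norm a) else a.[-1].

Section Evaluation.
Variable S : comNzRingType.
Local Notation ev a r := ((map_poly (intr : int -> S) a).[r]).

Lemma eval_even_odd (a : {poly int}) (r : S) :
  ev a r = ev (even_poly a) (r ^+ 2) + ev (odd_poly a) (r ^+ 2) * r.
Proof.
rewrite -{1}(poly_even_odd a) rmorphD rmorphM /= !map_comp_poly /= map_polyXn map_polyX.
by rewrite hornerD hornerM !horner_comp !hornerXn hornerX.
Qed.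

Lemma eval_half_norm (a : {poly int}) (r : S) :
  ev (half_norm a) (r ^+ 2) = ev a r * ev a (- r).
Proof.
rewrite /half_norm rmorphB /= [map_poly _ ('X * _)]rmorphM /= map_polyX !rmorphXn /=.
rewrite !(eval_even_odd a) sqrrN.
by rewrite hornerD hornerN horner_exp [('X * _).[_]]hornerM hornerX horner_exp; ring.
Qed.

(** Any commutative ring is allowed because the lemma is applied over Z/p^2 as well as in fields. *)
Lemma tower_norm_root (j : nat) (a : {poly int}) (r : S) :
  r ^+ (2 ^ j) = -1 -> ev a r = 0 -> (tower_norm j a)%:~R = 0 :> S.
Proof.
elim: j a r => [|j IH] a r /= hr ha.
  by rewrite -horner_map /= rmorphN rmorph1 -hr expr1.
apply: (IH _ (r ^+ 2)); first by rewrite -exprM -expnS.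
by rewrite eval_half_norm ha mul0r.
Qed.

End Evaluation.

Section RootExists.
Variable L : fieldType.
Local Notation ev a r := ((map_poly (intr : int -> L) a).[r]).

(** A converse in a field with enough roots of unity: a root of [half_norm a] is a power of z^2,
    hence a square, and one of its two square roots is a root of [a]. *)
Lemma root_tower_norm (j : nat) (a : {poly int}) (z : L) :
  (2 ^ j.+1).-primitive_root z -> (tower_norm j a)%:~R = 0 :> L ->
  exists2 r : L, r ^+ (2 ^ j) = -1 & ev a r = 0.
Proof.
elim: j a z => [|j IH] a z hz /= h.
  by exists (-1); rewrite // -(rmorphN1 (intr : {rmorphism int -> L})) horner_map.
have hz2 : (2 ^ j.+1).-primitive_root (z ^+ 2).
  have := dvdn_prim_root hz (dvdn_exp2l 2 (leqnSn j.+1)).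
  by rewrite -expnB // subSnn.
have [t ht hat] := IH _ _ hz2 h.
have [k hk] : exists k, t = (z ^+ 2) ^+ k.
  have [|k ->] := prim_rootP hz2 (x := t); last by exists k.
  by rewrite expnSr exprM ht sqrrN expr1n.
have hs : t = (z ^+ k) ^+ 2 by rewrite hk -!exprM mulnC.
have hr : (z ^+ k) ^+ (2 ^ j.+1) = -1 by rewrite expnS exprM -hs.
move/eqP: hat; rewrite hs eval_half_norm mulf_eq0 => /orP[] /eqP h0.
  by exists (z ^+ k).
exists (- z ^+ k) => //.
by rewrite exprNn hr -signr_odd oddX /= mul1r.
Qed.
End RootExists.

Lemma tower_norm_congr (j : nat) (a c : {poly int}) (m : int) :
  (tower_norm j (a + m *: c) = tower_norm j a %[mod m])%Z.
Proof.
elim: j a c => [|j IH] a c /=.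
  by apply/eqP; rewrite hornerD hornerZ eqz_mod_dvd addrAC subrr add0r dvdz_mulr.
have -> : half_norm (a + m *: c) = half_norm a +
   m *: (even_poly a * even_poly c *+ 2 + m *: even_poly c ^+ 2
     - 'X * (odd_poly a * odd_poly c *+ 2 + m *: odd_poly c ^+ 2)).
  rewrite /half_norm !linearD !linearZ /= -!mul_polyC; ring.
exact: IH.
Qed.

(** The last descent step is evaluated at -1, where E^2 - X O^2 becomes a sum of two squares. *)
Lemma tower_norm_ge0 (j : nat) (a : {poly int}) : 0 <= tower_norm j.+1 a.
Proof.
elim: j a => [|j IH] a; last exact: (IH (half_norm a)).
rewrite /= /half_norm hornerD hornerN horner_exp [('X * _).[_]]hornerM hornerX.
by rewrite horner_exp mulN1r opprK addr_ge0 ?sqr_ge0.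
Qed.

(** * The l1 norm and the size of norms *)

Definition l1norm (a : {poly int}) : int := \sum_(i < size a) `|a`_i|.

Lemma l1normE (n : nat) (a : {poly int}) : (size a <= n)%N ->
  l1norm a = \sum_(i < n) `|a`_i|.
Proof.
move=> h; rewrite /l1norm (big_ord_widen _ (fun i => `|a`_i|) h) big_mkcond /=.
by apply: eq_bigr => i _; case: ltnP => // hi; rewrite nth_default ?normr0.
Qed.

Lemma l1norm_ge0 a : 0 <= l1norm a.
Proof. by apply: sumr_ge0 => i _. Qed.

Lemma l1normD a b : l1norm (a + b) <= l1norm a + l1norm b.
Proof.
pose n := maxn (size a) (size b).
rewrite !(@l1normE n) ?leq_maxl ?leq_maxr ?size_polyD // -big_split /=.
by apply: ler_sum => i _; rewrite coefD ler_normD.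
Qed.

Lemma l1normN a : l1norm (- a) = l1norm a.
Proof. by rewrite /l1norm size_polyN; apply: eq_bigr => i _; rewrite coefN normrN. Qed.

Lemma l1normZ c a : l1norm (c *: a) = `|c| * l1norm a.
Proof.
rewrite (@l1normE (size a)) ?size_scale_leq // /l1norm mulr_sumr.
by apply: eq_bigr => i _; rewrite coefZ normrM.
Qed.

Lemma l1normMX a : l1norm ('X * a) = l1norm a.
Proof.
rewrite (@l1normE (size a).+1); last first.
  by rewrite mulrC; have [->|h] := eqVneq a 0; rewrite ?mul0r ?size_poly0 ?size_mulX.
rewrite big_ord_recl coefXM normr0 add0r; apply: eq_bigr => i _.
by rewrite coefXM.
Qed.

Lemma l1normM a b : l1norm (a * b) <= l1norm a * l1norm b.
Proof.
elim/poly_ind: a => [|p c IH]; first by rewrite mul0r /l1norm size_poly0 !big_ord0 mul0r.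
have hpc : l1norm (p * 'X + c%:P) = l1norm p + `|c|.
  rewrite (@l1normE (size p).+1).
    rewrite big_ord_recl coefD coefMX coefC /= add0r addrC; congr (_ + _).
    by apply: eq_bigr => i _; rewrite coefD coefMX coefC /= addr0.
  by rewrite size_MXaddC; case: ifP.
rewrite hpc mulrDl mul_polyC mulrDl; apply: le_trans (l1normD _ _) _.
by rewrite l1normZ lerD2r -mulrA mulrCA l1normMX.
Qed.

Lemma l1norm_even_odd a : l1norm (even_poly a) + l1norm (odd_poly a) = l1norm a.
Proof.
rewrite (@l1normE (size a)); last first.
  by rewrite (leq_trans (size_even_poly _)) // leq_uphalf_double -addnn leq_addr.
rewrite (@l1normE (size a) (odd_poly a)); last first.
  by rewrite (leq_trans (size_odd_poly _)) // leq_half_double -addnn -addnS leq_addr.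
rewrite (@l1normE (size a).*2 a) -?addnn ?leq_addr // addnn -big_split /=.
elim: (size a) => [|n IH]; first by rewrite !big_ord0.
by rewrite doubleS !big_ord_recr /= -IH coef_even_poly coef_odd_poly addrA.
Qed.

(** A descent step at most squares the l1 norm, which is submultiplicative and additive over the
    even and odd parts. *)
Lemma tower_norm_le (j : nat) (a : {poly int}) :
  `|tower_norm j a| <= l1norm a ^+ (2 ^ j).
Proof.
elim: j a => [|j IH] a /=.
  rewrite expr1 horner_coef /l1norm; apply: le_trans (ler_norm_sum _ _ _) _.
  by apply: ler_sum => i _; rewrite normrM normrX normrN1 expr1n mulr1.
apply: le_trans (IH _) _; rewrite expnS exprM lerXn2r ?nnegrE ?l1norm_ge0 //.
  exact: exprn_ge0 (l1norm_ge0 _).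
rewrite /half_norm; apply: le_trans (l1normD _ _) _.
rewrite l1normN l1normMX -(l1norm_even_odd a).
have := l1normM (even_poly a) (even_poly a).
have := l1normM (odd_poly a) (odd_poly a).
have := l1norm_ge0 (even_poly a); have := l1norm_ge0 (odd_poly a).
rewrite -!expr2 sqrrD; nia.
Qed.

(** * Norms modulo X^(2^j) + 1 and modulo powers of 2 *)

Lemma even_odd_polyE (R : nzRingType) (u v : {poly R}) :
  even_poly (u \Po 'X^2 + (v \Po 'X^2) * 'X) = u /\
  odd_poly (u \Po 'X^2 + (v \Po 'X^2) * 'X) = v.
Proof.
split; apply/polyP => i.
  rewrite coef_even_poly coefD coefMX !coef_comp_poly_Xn // dvdn2 odd_double /=.
  rewrite -{1}muln2 mulnK //; case: i => [|i]; rewrite ?addr0 //=.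
  by rewrite dvdn2 /= odd_double addr0.
rewrite coef_odd_poly coefD coefMX !coef_comp_poly_Xn // !dvdn2 /= odd_double /=.
by rewrite add0r -muln2 mulnK.
Qed.

(** The norm depends only on the value at z: X^(2^(j+1)) + 1 is X^(2^j) + 1 composed with X^2, so
    the even and odd parts change by multiples of X^(2^j) + 1. *)
Lemma tower_norm_mod (j : nat) (a q : {poly int}) :
  tower_norm j (a + ('X^(2 ^ j) + 1) * q) = tower_norm j a.
Proof.
elim: j a q => [|j IH] a q /=.
  by rewrite expn0 expr1 hornerD hornerM hornerD hornerX hornerC addNr mul0r addr0.
pose D := 'X^(2 ^ j) + 1 : {poly int}.
have hD : 'X^(2 ^ j.+1) + 1 = D \Po 'X^2.
  by rewrite /D comp_polyD comp_polyC rmorphXn /= comp_polyX -exprM -expnS.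
have [he ho] := even_odd_polyE (even_poly a + D * even_poly q) (odd_poly a + D * odd_poly q).
have heq : a + ('X^(2 ^ j.+1) + 1) * q =
  ((even_poly a + D * even_poly q) \Po 'X^2) +
  ((odd_poly a + D * odd_poly q) \Po 'X^2) * 'X.
  rewrite -{1}(poly_even_odd a) -{1}(poly_even_odd q) hD !comp_polyD !comp_polyM.
  rewrite /D comp_polyD; ring.
rewrite heq /half_norm he ho -(IH (even_poly a ^+ 2 - 'X * odd_poly a ^+ 2)
  (even_poly a * even_poly q *+ 2 + D * even_poly q ^+ 2
     - 'X * (odd_poly a * odd_poly q *+ 2 + D * odd_poly q ^+ 2))).
congr tower_norm; rewrite -/D; ring.
Qed.

(** One step sends m to the m' with 1 + 4 m' = (1 + 4 m)^2, so the result is ((1 + 4 m)^(2^j) - 1) /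
    4. *)
Fixpoint norm_seed (m : int) (j : nat) : int :=
  if j is j'.+1 then norm_seed (m * (2 + 4 * m)) j' else m.

Definition geom_poly (d : nat) : {poly int} := \poly_(k < d) 1.

Lemma even_geom_poly d : even_poly (geom_poly d.*2) = geom_poly d.
Proof. by apply/polyP=> i; rewrite coef_even_poly !coef_poly ltn_double. Qed.

Lemma odd_geom_poly d : odd_poly (geom_poly d.*2) = geom_poly d.
Proof. by apply/polyP=> i; rewrite coef_odd_poly !coef_poly ltn_Sdouble. Qed.

Lemma geom_polyM d : geom_poly d * (1 - 'X) = 1 - 'X^d.
Proof.
by rewrite /geom_poly poly_def -[RHS]opprB subrX1 mulrC -mulNr opprB; congr (_ * _);
  apply: eq_bigr => i _; rewrite scale1r.
Qed.

(* [geom_poly (2 ^ j)] takes the value [2 / (1 - z)] at the root of unity [z]; the norm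
   computed here is [((1 + 4 * m) ^ (2 ^ j) + 1) / 2]. *)
Lemma tower_norm_geom (j : nat) (m : int) :
  tower_norm j (1 + (2 * m) *: geom_poly (2 ^ j)) = 1 + 2 * norm_seed m j.
Proof.
elim: j m => [|j IH] m /=.
  by rewrite hornerD hornerC hornerZ /geom_poly poly_def big_ord_recl big_ord0
    addr0 scale1r hornerC mulr1.
(* With d = 2^j, the product g (1 - X) = 1 - X^d is 2 modulo X^d + 1; this turns m into m (2 + 4
   m). *)
rewrite -IH -(tower_norm_mod j (1 + _) ((- 4 * m ^+ 2)%:P * geom_poly (2 ^ j))).
congr tower_norm.
rewrite /half_norm !linearD !linearZ /= expnS mul2n even_geom_poly odd_geom_poly.
rewrite -[1](polyC1) even_polyC odd_polyC add0r polyC1.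
set g := geom_poly _; rewrite -!mul_polyC !(rmorphM, rmorphD, rmorphN, rmorphXn) /= polyC1.
have : g * (1 - 'X) = 1 - 'X^(2 ^ j) := geom_polyM _.
move: (m%:P) => c /(congr1 (fun h => 4 * c ^+ 2 * g * h)) /= h.
apply: subr0_eq; move/eqP: h; rewrite -subr_eq0 => /eqP <-; ring.
Qed.

(** In m (2 + 4 m) = 2 m (1 + 2 m) the last factor is odd, so each step raises the 2-adic valuation
    by exactly one. *)
Lemma norm_seed_mod (j : nat) (m q : int) (k : nat) : m = 2 ^+ k * (1 + 2 * q) ->
  (2 * norm_seed m j = 2 ^+ (k + j).+1 %[mod 2 ^+ (k + j).+2])%Z.
Proof.
elim: j m q k => [|j IH] m q k hm /=.
  rewrite addn0 hm mulrA -exprS mulrDr mulr1 mulrA -exprSr -[LHS]modzDmr.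
  by rewrite modzMr addr0.
rewrite addnS -addSn; apply: (IH _ (q + m + 2 * q * m)).
rewrite hm exprS; ring.
Qed.

(** This is the residue defining the progression of index j + 1. Every odd [m] is allowed, so [m]
    can later absorb all small odd primes. *)
Lemma tower_norm_seed (j m : nat) : odd m ->
  (tower_norm j (1 + (2 * m%:Z) *: geom_poly (2 ^ j))
     = (2 ^ j.+1 + 1)%N %[mod (2 ^ j.+2)%N])%Z.
Proof.
move=> om; rewrite tower_norm_geom addrC PoszD -[LHS]modzDml -[RHS]modzDml.
congr (modz (_ + _) _).
have := @norm_seed_mod j m%:Z m./2%:Z 0; rewrite expr0 mul1r add0n -!natz !natrX !natz.
by apply; rewrite -{1}(odd_double_half m) om -mul2n; lia.
Qed.

(** * Nonvanishing of norms and their divisibility by primes *)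

Lemma prim_root_pow2 (L : fieldType) (j : nat) (r : L) :
  (-1 != 1 :> L) -> r ^+ (2 ^ j) = -1 -> (2 ^ j.+1).-primitive_root r.
Proof.
move=> h1 hr; have h0 : (0 < 2 ^ j.+1)%N by rewrite expn_gt0.
have [|m hm] := prim_order_exists (z := r) h0.
  by rewrite expnSr exprM hr sqrrN expr1n.
case/(dvdn_pfactor _ _ (isT : prime 2)) => k hk hmk; move: hm; rewrite hmk => hm.
suff -> : j.+1 = k by [].
apply/eqP; rewrite eq_sym; move: hk; rewrite leq_eqVlt => /orP[//|hk].
case/eqP: h1; rewrite -hr -(subnKC (_ : k <= j)%N) // expnD exprM.
by rewrite (prim_expr_order hm) expr1n.
Qed.

(** A zero norm would give [a] a primitive 2^(j+1)-th root of unity as a complex root, whose minimal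
    polynomial is cyclotomic of degree 2^j, too large to divide [a]. *)
Lemma tower_norm_neq0 (j : nat) (a : {poly int}) :
  (size a <= 2 ^ j)%N -> a != 0 -> tower_norm j a != 0.
Proof.
move=> sa; apply: contraNN => h.
have h0 : (0 < 2 ^ j.+1)%N by rewrite expn_gt0.
have [z hz] := C_prim_root_exists h0.
have [r hr har] : exists2 r : algC, r ^+ (2 ^ j) = -1 & (map_poly intr a).[r] = 0.
  by apply: root_tower_norm hz _; rewrite (eqP h).
have {}hr : (2 ^ j.+1).-primitive_root r.
  by apply: prim_root_pow2 hr; rewrite -subr_eq0 -opprD oppr_eq0 (pnatr_eq0 _ 2).
have [p [hp _] dvp] := minCpolyP r.
have hz2 : map_poly (ratr : rat -> algC) (map_poly (intr : int -> rat) a)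
   = map_poly (intr : int -> algC) a.
  by rewrite -map_poly_comp; apply: eq_map_poly => x /=; rewrite ratr_int.
have := dvp (map_poly intr a); rewrite hz2 rootE har eqxx => /esym hdv.
apply: contraTT sa => a0; rewrite -ltnNge.
have ha : map_poly (intr : int -> rat) a != 0.
  by rewrite -size_poly_eq0 size_map_inj_poly ?size_poly_eq0 //; exact: intr_inj.
have := dvdp_leq ha hdv.
rewrite -(size_map_poly (ratr : {rmorphism rat -> algC}) p) -hp (minCpoly_cyclotomic hr).
rewrite size_cyclotomic totient_pfactor //= mul1n => /leq_trans; apply.
exact: size_poly.
Qed.

Lemma finField_prim_root (F : finFieldType) (n : nat) :
  (n %| #|F|.-1)%N -> exists z : F, n.-primitive_root z.
Proof.
move=> hn; have hF := finNzRing_gt1 F.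
have hF0 : (0 < #|F|.-1)%N by rewrite -ltnS prednK // ltnW.
suff [z hz] : exists z : F, (#|F|.-1).-primitive_root z.
  by exists (z ^+ (#|F|.-1 %/ n)); apply: dvdn_prim_root.
have [] := hasP (has_prim_root (rs := [seq x <- enum F | x != 0]) hF0 _ _ _).
- apply/allP => x; rewrite mem_filter => /andP[hx _].
  rewrite unity_rootE; apply/eqP; apply: (mulIf hx).
  by rewrite -exprSr prednK 1?ltnW // expf_card mul1r.
- by rewrite filter_uniq // enum_uniq.
- have := count_predC (pred1 (0 : F)) (enum F).
  rewrite (count_uniq_mem _ (enum_uniq F)) mem_enum -cardE size_filter.
  by rewrite (@eq_count _ (predC (pred1 0)) (fun x : F => x != 0)) // => <-.
by move=> z _ hz; exists z.
Qed.

(** By Euler's theorem [n] divides p^(totient n) - 1, so the field with p^(totient n) elements will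
    do. *)
Lemma pchar_prim_root_exists (p n : nat) : prime p -> coprime p n -> (0 < n)%N ->
  exists2 L : fieldType, p \in [pchar L] & exists z : L, n.-primitive_root z.
Proof.
move=> pp cpn n0; have t0 : (0 < totient n)%N by rewrite totient_gt0.
have [F hp hF] := pPrimePowerField pp t0.
exists F => //; apply: finField_prim_root.
rewrite hF -subn1 -eqn_mod_dvd ?expn_gt0 ?prime_gt0 //.
exact/eqP/Euler_exp_totient.
Qed.

Lemma intr_Zp_eq0 (n : nat) (z : int) : (1 < n)%N ->
  (z%:~R == 0 :> 'Z_n) = (n%:Z %| z)%Z.
Proof.
move=> n1; have hn (k : nat) : (k%:R == 0 :> 'Z_n) = (n %| k)%N.
  by rewrite /dvdn -val_Zp_nat // -(inj_eq val_inj).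
case: z => k; first exact: hn.
by rewrite NegzE rmorphN oppr_eq0 dvdzE abszN; exact: hn.
Qed.

(** Descend to the level where [p] has the roots of unity of the lower field but not those of the
    next quadratic extension. There a zero of E^2 - X O^2 modulo [p] is not a square, so both E and
    O vanish at it, and E^2 - X O^2 vanishes modulo p^2 at a suitable lift. *)
Lemma sqr_dvd_tower_norm (p j : nat) (a : {poly int}) : prime p -> odd p ->
  (p != 1 %[mod 2 ^ j.+1])%N -> (p%:Z %| tower_norm j a)%Z ->
  ((p ^ 2)%N%:Z %| tower_norm j a)%Z.
Proof.
move=> pp op; elim: j a => [|j IH] a /=.
  by rewrite expn1 !modn2 op.
move=> hp2 hdv; have [hp|hp] := boolP (p == 1 %[mod 2 ^ j.+1]); last exact: IH.
have p1 : (1 < p)%N := prime_gt1 pp.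
have chp : p \in [pchar 'F_p] by rewrite pchar_Fp.
have hpd : (2 ^ j.+1 %| p.-1)%N by rewrite -subn1 -eqn_mod_dvd // ltnW.
have [z hz] : exists z : 'F_p, (2 ^ j.+1).-primitive_root z.
  by apply: finField_prim_root; rewrite card_Fp.
have n1 : -1 != 1 :> 'F_p.
  rewrite -subr_eq0 -opprD oppr_eq0 -(dvdn_pcharf chp 2) dvdn_prime2 //.
  by apply: contraTneq op => ->.
have [r hr] : exists2 r : 'F_p, r ^+ (2 ^ j) = -1 & (map_poly intr (half_norm a)).[r] = 0.
  by apply: root_tower_norm hz _; apply/eqP; rewrite -(dvdz_pcharf chp).
set E := even_poly a; set O := odd_poly a.
have evE (b : {poly int}) (x : int) : (map_poly intr b).[x%:~R] = b.[x]%:~R :> 'F_p.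
  by rewrite horner_map.
rewrite /half_norm -/E -/O rmorphB /= [map_poly _ ('X * _)]rmorphM /= map_polyX !rmorphXn /=.
rewrite hornerD hornerN horner_exp [('X * _).[_]]hornerM hornerX horner_exp => hEO.
(* Otherwise r = (E(r) / O(r))^2, and the square root is a primitive 2^(j+2)-th root of unity in
   F_p, which forces p = 1 modulo 2^(j+2). *)
have hO : (map_poly intr O).[r] = 0 :> 'F_p.
  apply/eqP; apply: contraT => nO; case/negP: hp2.
  pose t := (map_poly intr E).[r] / (map_poly intr O).[r].
  have ht : t ^+ 2 = r.
    by rewrite expr_div_n; move/eqP: hEO; rewrite subr_eq0 => /eqP ->; rewrite mulfK ?expf_neq0.
  have hpr : (2 ^ j.+2).-primitive_root t.
    by apply: prim_root_pow2 => //; rewrite expnS exprM ht.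
  have t0 : t != 0.
    apply: contra_eq_neq ht => ->; rewrite expr0n /= eq_sym.
    by apply: contra_eq_neq hr => ->; rewrite expr0n expn_eq0 /= eq_sym oppr_eq0 oner_eq0.
  have hp1 : t ^+ p.-1 = 1.
    apply: (mulIf t0); rewrite -exprSr (prednK (prime_gt0 pp)) mul1r.
    by have := expf_card t; rewrite card_Fp.
  by rewrite eqn_mod_dvd ?prime_gt0 // subn1 (prim_order_dvd hpr) hp1.
have hE : (map_poly intr E).[r] = 0 :> 'F_p.
  by move/eqP: hEO; rewrite hO expr0n mulr0 subr0 sqrf_eq0 => /eqP.

pose r0 : int := (r : nat)%:Z; have hr0 : r0%:~R = r by rewrite /r0 -[RHS]natr_Zp.
(* Taking p-th powers lifts a congruence modulo p to one modulo p^2, so s^(2^j) = -1 modulo p^2,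
   while s still reduces to r. *)
pose s := r0 ^+ p.
have hs : s%:~R = r by rewrite rmorphXn /= hr0; have := expf_card r; rewrite card_Fp.
have sE : (p%:Z %| E.[s])%Z by rewrite (dvdz_pcharf chp) -evE hs hE.
have sO : (p%:Z %| O.[s])%Z by rewrite (dvdz_pcharf chp) -evE hs hO.
have p2 : (1 < p ^ 2)%N by rewrite (@ltn_exp2l p 0) //.
have hsr : s%:~R ^+ (2 ^ j) = -1 :> 'Z_(p ^ 2).
  apply/eqP; rewrite -subr_eq0 opprK -(rmorphXn (intr : {rmorphism int -> _})).
  rewrite -[1]/(1%:~R) -rmorphD /= intr_Zp_eq0 //.
  rewrite -exprM mulnC exprM -[1]opprK.
  rewrite -[- 1 in X in _ - X](_ : (-1) ^+ p = -1); last by rewrite -signr_odd op.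
  rewrite subrXX -mulnn PoszM dvdz_mul // (dvdz_pcharf chp).
    by rewrite rmorphB rmorphXn /= hr0 hr rmorphN1 subrr.
  rewrite rmorph_sum /= (eq_bigr (fun=> (-1) ^+ p.-1)) => [|i _].
    by rewrite sumr_const card_ord -mulr_natr (pcharf0 chp) mulr0.
  rewrite rmorphM !rmorphXn /= hr0 hr rmorphN1 -exprD; congr (_ ^+ _).
  by rewrite subnK // -ltnS (prednK (prime_gt0 pp)).
rewrite -intr_Zp_eq0 //; apply/eqP; apply: (tower_norm_root hsr).
rewrite horner_map /=; apply/eqP; rewrite intr_Zp_eq0 // /half_norm -/E -/O.
rewrite hornerD hornerN horner_exp [('X * _).[_]]hornerM hornerX horner_exp.
rewrite rpredB //; last apply: dvdz_mull; rewrite expr2 -mulnn PoszM dvdz_mul //.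
Qed.

(** * Counting box points of given norm residue *)

Lemma card_le_sum (T I : finType) (P : pred I) (A : {set T}) (F : I -> {set T}) :
  (forall x, x \in A -> exists2 i, P i & x \in F i) ->
  (#|A| <= \sum_(i | P i) #|F i|)%N.
Proof.
move=> h; under eq_bigr do rewrite -sum1_card big_mkcond /=.
rewrite exchange_big /= -sum1_card big_mkcond /=; apply: leq_sum => x _.
by case: ifP => // /h [i Pi xi]; rewrite (bigD1 i) //= xi.
Qed.

Lemma dist_same_cell (l x y : nat) : (0 < l)%N -> (x %/ l = y %/ l)%N ->
  `|x%:Z - y%:Z| <= l.-1%:Z.
Proof.
move=> l0 h; rewrite (divn_eq x l) (divn_eq y l) h.
by have := ltn_pmod x l0; have := ltn_pmod y l0; lia.
Qed.

Definition box_poly (d Y : nat) (b : {ffun 'I_d -> 'I_Y}) : {poly int} :=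
  rVpoly (\row_(i < d) (b i : nat)%:Z).

Lemma coef_box_poly (d Y : nat) (b : {ffun 'I_d -> 'I_Y}) (i : 'I_d) :
  (box_poly b)`_i = (b i : nat)%:Z.
Proof. by rewrite /box_poly coef_rVpoly_ord mxE. Qed.

Lemma size_box_poly (d Y : nat) (b : {ffun 'I_d -> 'I_Y}) : (size (box_poly b) <= d)%N.
Proof. exact: size_poly. Qed.

(* A lower bound for the size of the residue fields of [Z[z]] above [p]. *)
Definition residue_weight (j p w : nat) :=
  w = p \/ w = (p ^ 2)%N /\ (p != 1 %[mod 2 ^ j.+1])%N.

Lemma residue_weight_dvd (j p w : nat) (a : {poly int}) : prime p -> odd p ->
  residue_weight j p w -> (p%:Z %| tower_norm j a)%Z -> (w%:Z %| tower_norm j a)%Z.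
Proof. by move=> pp op [->|[-> h]] //; exact: sqr_dvd_tower_norm. Qed.

(* Two points of one residue class lying in a common cell of side [l] would
   differ by a nonzero element of norm less than [w] but divisible by [w]. *)
Lemma card_box_root (j p w Y : nat) (L : fieldType) (r : L) (a0 : {poly int}) (M : int) :
  prime p -> odd p -> p \in [pchar L] -> r ^+ (2 ^ j) = -1 -> ~~ (p%:Z %| M)%Z ->
  residue_weight j p w ->
  (#|[set b : {ffun 'I_(2 ^ j) -> 'I_Y} |
       ((map_poly (intr : int -> L) (a0 + M *: box_poly b)).[r] == 0)%R]| * w
   <= (2 * 2 ^ j * Y) ^ (2 ^ j) + w)%N.
Proof.
move=> pp op chp hr hM hw; set G := finset _; set d := (2 ^ j)%N in G *.
have d0 : (0 < d)%N by rewrite expn_gt0.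
have p0 := prime_gt0 pp.
have w0 : (0 < w)%N by case: hw => [->|[-> _]]; rewrite ?expn_gt0 p0.
have exl : exists l, (w <= (d * l) ^ d)%N.
  exists w; apply: leq_trans (leq_pexp2l _ d0); rewrite ?expn1 ?leq_pmull ?muln_gt0 ?d0 //.
(* The side [l] is least with (d l)^d >= w: coefficients of a difference within a cell are at most l
   - 1, so by minimality its norm is below [w]. *)
have [l hl minl] := ex_minnP exl.
have l0 : (0 < l)%N by case: l hl {minl} => //; rewrite muln0 exp0n // leqNgt w0.
have hl1 : ((d * l.-1) ^ d < w)%N.
  by rewrite ltnNge; apply/negP => /minl; rewrite leqNgt ltn_predL l0.
pose cell (b : {ffun 'I_d -> 'I_Y}) : {ffun 'I_d -> 'I_(Y %/ l).+1} :=
  [ffun i => inord (b i %/ l)].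
have cellE b b' i : cell b = cell b' -> (b i %/ l = b' i %/ l)%N.
  move/ffunP/(_ i)/(congr1 (@nat_of_ord _)); rewrite !ffunE !inordK // ltnS leq_div2r //;
  exact: ltnW.
have inj : {in G &, injective cell}.
  move=> b b'; rewrite !inE => /eqP hb /eqP hb' hc.
  pose c := box_poly b - box_poly b'.
  have hcr : (map_poly intr c).[r] = 0 :> L.
    have : (map_poly intr (M *: c)).[r] = 0 :> L.
      have -> : M *: c = (a0 + M *: box_poly b) - (a0 + M *: box_poly b').
        by rewrite /c scalerBr opprD addrACA subrr add0r.
      by rewrite rmorphB hornerD hornerN hb hb' subrr.
    rewrite map_polyZ hornerZ => /eqP; rewrite mulf_eq0 -(dvdz_pcharf chp) (negbTE hM).
    by move/eqP.
  have hpN : (p%:Z %| tower_norm j c)%Z.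
    by rewrite (dvdz_pcharf chp) (tower_norm_root hr hcr).
  have hwN := residue_weight_dvd pp op hw hpN.
  have sc : (size c <= d)%N
    by rewrite (leq_trans (size_polyD _ _)) // size_polyN geq_max !size_box_poly.
  have c0 : c = 0.
    apply/eqP; apply: contraT => nc; have nN := tower_norm_neq0 sc nc.
    have : (`|tower_norm j c| < w)%N.
      rewrite -ltz_nat; apply: le_lt_trans (_ : ((d * l.-1) ^ d)%N%:Z < _); last by rewrite ltz_nat.
      apply: le_trans (tower_norm_le _ _) _.
      rewrite -/d -[leRHS]natz natrX lerXn2r ?nnegrE ?l1norm_ge0 //.
      rewrite natz (l1normE sc); apply: le_trans (_ : \sum_(i < d) l.-1%:Z <= _).
        apply: ler_sum => i _; rewrite coefB !coef_box_poly.
        exact: dist_same_cell (cellE _ _ i hc).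
      by rewrite sumr_const card_ord -mulr_natr mulrC PoszM natz.
    have : (w <= `|tower_norm j c|)%N.
      by apply: dvdn_leq; rewrite ?absz_gt0.
    by move=> h1 h2; have := leq_ltn_trans h1 h2; rewrite ltnn.
  apply/ffunP => i; apply: val_inj; apply/eqP; rewrite -eqz_nat -!coef_box_poly -subr_eq0.
  by rewrite -coefB -/c c0 coef0.
have hG : (#|G| <= (Y %/ l).+1 ^ d)%N.
  by rewrite -(card_in_imset inj) (leq_trans (max_card _)) // card_ffun !card_ord.
(* If Y < l there is only one cell; this case is the source of the summand [w]. *)
have [hY|hY] := ltnP Y l.
  rewrite divn_small // exp1n in hG; apply: leq_trans (leq_addl _ _).
  by apply: leq_trans (leq_mul hG (leqnn w)) _; rewrite mul1n.
apply: leq_trans (leq_addr _ _); apply: leq_trans (leq_mul hG hl) _.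
rewrite -expnMn leq_exp2r //.
have h : ((Y %/ l).+1 * l <= 2 * Y)%N.
  by rewrite mulSn mul2n -addnn leq_add // leq_trunc_div.
by rewrite mulnCA (mulnC 2) -mulnA leq_mul2l h orbT.
Qed.

(** In characteristic [p], divisibility of the norm means that one of the powers of a primitive
    2^(j+1)-th root of unity is a root; the bound for one root is summed over all of them. *)
Lemma card_box_dvd (j p w Y : nat) (a0 : {poly int}) (M : int) :
  prime p -> odd p -> ~~ (p%:Z %| M)%Z -> residue_weight j p w ->
  (#|[set b : {ffun 'I_(2 ^ j) -> 'I_Y} |
       (p%:Z %| tower_norm j (a0 + M *: box_poly b)%R)%Z]| * w
   <= 2 ^ j.+1 * ((2 * 2 ^ j * Y) ^ (2 ^ j) + w))%N.
Proof.
move=> pp op hM hw; have hc : coprime p (2 ^ j.+1).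
  by rewrite coprime_sym coprimeXl // coprime2n.
have [|L chp [z hz]] := pchar_prim_root_exists pp hc; first by rewrite expn_gt0.
pose F (k : 'I_(2 ^ j.+1)) := [set b : {ffun 'I_(2 ^ j) -> 'I_Y} |
       (map_poly (intr : int -> L) (a0 + M *: box_poly b)).[z ^+ k] == 0].
set A := finset _.
have hA : (#|A| <= \sum_(k : 'I_(2 ^ j.+1) | ((z ^+ k) ^+ (2 ^ j) == -1)%R) #|F k|)%N.
  apply: card_le_sum => b; rewrite inE (dvdz_pcharf chp) => /eqP /(root_tower_norm hz)[r hr har].
  have [|k hk] := prim_rootP hz (x := r); first by rewrite expnSr exprM hr sqrrN expr1n.
  by exists k; rewrite -?hk ?hr // inE -hk har.
apply: leq_trans (leq_mul hA (leqnn w)) _; rewrite big_distrl /=.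
apply: leq_trans (_ : \sum_(k : 'I_(2 ^ j.+1)) ((2 * 2 ^ j * Y) ^ (2 ^ j) + w) <= _)%N.
  rewrite big_mkcond /=; apply: leq_sum => k _; case: ifP => // /eqP hk.
  exact: (card_box_root Y a0 pp op chp hk hM hw).
by rewrite sum_nat_const card_ord.
Qed.

(** * Box points with norms in the progression *)

Lemma eq1_mod_primes (q n : nat) : (0 < n)%N ->
  (forall p, prime p -> (p %| n)%N -> p = 1 %[mod q])%N -> (n = 1 %[mod q])%N.
Proof.
elim/ltn_ind: n => n IH n0 h; have [->//|n1] := eqVneq n 1%N.
have pp : prime (pdiv n) by apply: pdiv_prime; rewrite ltn_neqAle eq_sym n1.
have hp := pdiv_dvd n.
have dv0 : (0 < n %/ pdiv n)%N by rewrite divn_gt0 ?prime_gt0 // dvdn_leq.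
have h1 : (n %/ pdiv n = 1 %[mod q])%N.
  apply: IH => //; first by rewrite ltn_Pdiv // prime_gt1.
  move=> p' pp' hp'; apply: h => //; apply: dvdn_trans hp' (dvdn_div hp).
by rewrite -{1}(divnK hp) -modnMm (h _ pp hp) h1 modnMm muln1.
Qed.

(** For j = 0 the norm involves no sum of squares, and the sign comes from the constant
    coefficient. *)
Lemma tower_norm_ge0_nneg (j : nat) (a : {poly int}) : (size a <= 2 ^ j)%N ->
  (forall i, 0 <= a`_i) -> 0 <= tower_norm j a.
Proof.
case: j => [|j] sa ha; last exact: tower_norm_ge0.
by rewrite /= (size1_polyC sa) hornerC.
Qed.

Lemma tower_norm1 j : tower_norm j 1 = 1.
Proof.
have h : norm_seed 0 j = 0 by elim: j => //= j; rewrite mul0r.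
by have := tower_norm_geom j 0; rewrite mulr0 scale0r addr0 h mulr0 addr0.
Qed.

Definition good_prime (j p : nat) :=
  [&& prime p, odd p & (p != 1 %[mod 2 ^ j.+2])%N].

Definition prime_weight (j p : nat) :=
  if (p == 2 ^ j.+1 + 1 %[mod 2 ^ j.+2])%N then p else (p ^ 2)%N.

(** A number that is 1 modulo 2^(j+1) is either 1 or 2^(j+1) + 1 modulo 2^(j+2), so a good prime
    outside the progression is not 1 modulo 2^(j+1). *)
Lemma prime_weightP (j p : nat) : good_prime j p ->
  residue_weight j p (prime_weight j p).
Proof.
case/and3P => pp op hp; rewrite /prime_weight.
case: ifP => [_|/negP h]; [by left|right; split=> //].
apply/negP => /eqP h1; move: h hp; rewrite [(2 ^ j.+2)%N]expnS.
set q := (2 ^ j.+1)%N in h1 *; have q0 : (1 < q)%N by rewrite (@ltn_exp2l 2 0).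
have e : p = (p %/ q * q + 1)%N by rewrite {1}(divn_eq p q) h1 modn_small.
rewrite e; set k := (p %/ q)%N.
have hk : k = (odd k + k./2 * 2)%N by rewrite muln2 odd_double_half.
case: (boolP (odd k)) => o.
  have -> : (k * q + 1 = k./2 * (2 * q) + (q + 1))%N.
    by rewrite {1}hk o; clear; lia.
  by rewrite modnMDl eqxx.
have -> : (k * q + 1 = k./2 * (2 * q) + 1)%N.
  by rewrite {1}hk (negbTE o); clear; lia.
by rewrite modnMDl eqxx.
Qed.

(** The fixed point determines the norm modulo 2^(j+2), and all other terms being multiples of [m]
    makes the norm 1 modulo [m]. *)
Definition box_point (j m Y : nat) (b : {ffun 'I_(2 ^ j) -> 'I_Y}) : {poly int} :=
  (1 + (2 * m%:Z) *: geom_poly (2 ^ j)) + (2 ^ j.+2 * m)%N%:Z *: box_poly b.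

Lemma coef_box_point (j m Y : nat) (b : {ffun 'I_(2 ^ j) -> 'I_Y}) (i : 'I_(2 ^ j)) :
  (box_point m b)`_i = (((i : nat) == 0) + 2 * m + 2 ^ j.+2 * m * b i)%N%:Z.
Proof.
rewrite /box_point !coefD !coefZ coef1 coef_box_poly coef_poly ltn_ord mulr1.
by rewrite natz; set M := (2 ^ j.+2 * m)%N; lia.
Qed.

Lemma size_box_point (j m Y : nat) (b : {ffun 'I_(2 ^ j) -> 'I_Y}) :
  (size (box_point m b) <= 2 ^ j)%N.
Proof.
have h0 : (0 < 2 ^ j)%N by rewrite expn_gt0.
apply/leq_sizeP => i hi; rewrite !coefD !coefZ coef1 coef_poly ltnNge hi.
rewrite (gtn_eqF (leq_trans h0 hi)) mulr0 !add0r.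
by rewrite (nth_default _ (leq_trans (size_box_poly b) hi)) mulr0.
Qed.

Lemma box_bound (d m x Y e : nat) : (0 < m)%N -> (0 < d)%N -> (x < Y)%N -> (e <= 1)%N ->
  (e + 2 * m + 2 * (2 * d) * m * x <= 7 * d * m * Y)%N.
Proof.
move=> m0 d0 hx h1.
have h2 : (m <= d * m)%N by rewrite leq_pmull.
have h3 : (d * m * x + d * m <= d * m * Y)%N by rewrite -mulnSr leq_mul2l hx orbT.
lia.
Qed.

Lemma tower_norm_box_point (j m Y : nat) (b : {ffun 'I_(2 ^ j) -> 'I_Y}) :
  odd m -> exists2 n : nat, tower_norm j (box_point m b) = n%:Z &
    [/\ (n = 2 ^ j.+1 + 1 %[mod 2 ^ j.+2])%N, (n = 1 %[mod m])%N &
       (n <= (7 * 2 ^ j * 2 ^ j * m * Y) ^ (2 ^ j))%N].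
Proof.
move=> om; have sa := size_box_point m b.
have c0 i : 0 <= (box_point m b)`_i.
  case: (ltnP i (2 ^ j)) => hi; first by rewrite (coef_box_point m b (Ordinal hi)).
  by rewrite nth_default // (leq_trans sa).
have N0 := tower_norm_ge0_nneg sa c0.
exists `|tower_norm j (box_point m b)|%N; first by rewrite gez0_abs.
split.
- apply/eqP; rewrite -eqz_nat -!modz_nat gez0_abs //; apply/eqP.
  rewrite -(tower_norm_seed j om) /box_point.
  by rewrite PoszM -[(_ * _) *: box_poly b]scalerA tower_norm_congr.
- apply/eqP; rewrite -eqz_nat -!modz_nat gez0_abs //; apply/eqP.
  rewrite -[X in _ = (X %% _)%Z](tower_norm1 j) /box_point.
  rewrite (_ : _ + _ = 1 + m%:Z *: (2 *: geom_poly (2 ^ j) + (2 ^ j.+2)%N%:Z *: box_poly b)).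
    exact: tower_norm_congr.
  by rewrite scalerDr !scalerA -PoszM addrA [2 * _]mulrC [(m * _)%N]mulnC.
rewrite -lez_nat; apply: le_trans (tower_norm_le _ _) _.
rewrite -[leRHS]natz natrX lerXn2r ?nnegrE ?l1norm_ge0 // natz (l1normE sa).
apply: le_trans (_ : \sum_(i < 2 ^ j) (7 * 2 ^ j * m * Y)%N%:Z <= _).
  apply: ler_sum => i _; rewrite coef_box_point lez_nat.
  have m0 : (0 < m)%N by case: (m) om.
  have d0 : (0 < 2 ^ j)%N by rewrite expn_gt0.
  by rewrite 2!expnS; apply: box_bound => //; case: eqP.
rewrite sumr_const card_ord -mulr_natl natz -PoszM lez_nat.
by rewrite !mulnA; lia.
Qed.

(** The norm n of a box point is not 1 modulo 2^(j+2), so neither is some prime factor p. It is odd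
    since n is, exceeds [T] since n = 1 modulo [m], and its weight divides n, hence is at most
    [Z]. *)
Lemma box_count (j m T Y : nat) (d := (2 ^ j)%N) (Z := ((7 * d * d * m * Y) ^ d)%N) :
  odd m -> (forall p, prime p -> odd p -> (p <= T)%N -> (p %| m)%N) ->
  (Y ^ d <= \sum_(p < Z.+1 | [&& T < p, good_prime j p & prime_weight j p <= Z])
     #|[set b : {ffun 'I_d -> 'I_Y} | (p%:Z %| tower_norm j (box_point m b))%Z]|)%N.
Proof.
move=> om hT; have hY : (Y ^ d = #|[set: {ffun 'I_d -> 'I_Y}]|)%N.
  by rewrite cardsT card_ffun !card_ord.
rewrite hY; apply: card_le_sum => b _.
have [n hn [n4 nm nZ]] := tower_norm_box_point b om.
have q2 : (1 < 2 ^ j.+1)%N by rewrite (@ltn_exp2l 2 0).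
have q4 : (2 ^ j.+1 + 1 < 2 ^ j.+2)%N by rewrite [(2 ^ j.+2)%N]expnS mul2n -addnn ltn_add2l.
have n0 : (0 < n)%N.
  by case: (n) n4 => //; rewrite mod0n modn_small // addn1.
have /existsP[[p hpn] /= /and3P[pp hp hp1]] :
    [exists p : 'I_n.+1, [&& prime p, (p %| n)%N & (p != 1 %[mod 2 ^ j.+2])%N]].
  apply: contraT; rewrite negb_exists => /forallP hno.
  have : (n = 1 %[mod 2 ^ j.+2])%N.
    apply: eq1_mod_primes => // p pp hp; apply/eqP; have hpn := dvdn_leq n0 hp.
    by have := hno (Ordinal (hpn : (p < n.+1)%N)); rewrite /= pp hp /= negbK.
  rewrite n4 !modn_small //; last by rewrite (@ltn_exp2l 2 0).
  by move/eqP; rewrite addn1 eqSS expn_eq0.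
have op : odd p.
  have [hp2|//] := even_prime pp; move: hp; rewrite hp2 dvdn2 => /negP[].
  have o2 : odd (2 ^ j.+2) = false by rewrite oddX.
  by have := congr1 odd n4; rewrite !odd_mod // oddD oddX.
have gp : good_prime j p by rewrite /good_prime pp op hp1.
have pN : (p%:Z %| tower_norm j (box_point m b))%Z by rewrite hn.
have wZ : (prime_weight j p <= (7 * d * d * m * Y) ^ d)%N.
  apply: leq_trans nZ; apply: dvdn_leq => //.
  by have := residue_weight_dvd pp op (prime_weightP gp) pN; rewrite hn.
have pZ : (p < Z.+1)%N.
  rewrite ltnS; apply: leq_trans wZ; rewrite /prime_weight; case: ifP => // _.
  by rewrite leq_pmulr // prime_gt0.
exists (Ordinal pZ); last by rewrite inE.
rewrite /= gp wZ !andbT ltnNge; apply/negP => pT; have pm := hT _ pp op pT.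
have : (n = 1 %[mod p])%N by rewrite -(modn_dvdm n pm) nm modn_dvdm.
by rewrite (eqP hp) modn_small // prime_gt1.
Qed.

(** * Densities of periodic sets *)

Section Correlation.
Variable R : realFieldType.

Lemma chebyshev_sum (n : nat) (f g : 'I_n -> R) :
  (forall i k, 0 <= (f i - f k) * (g i - g k)) ->
  (\sum_i f i) * (\sum_i g i) <= n%:R * \sum_i f i * g i.
Proof.
move=> h; have : 0 <= \sum_i \sum_k (f i - f k) * (g i - g k).
  by apply: sumr_ge0 => i _; apply: sumr_ge0 => k _; exact: h.
have -> : \sum_i \sum_k (f i - f k) * (g i - g k) =
    \sum_i \sum_(k < n) f i * g i - \sum_i \sum_k f i * g k
    - (\sum_i \sum_k f k * g i - \sum_(i < n) \sum_k f k * g k).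
  rewrite -!sumrB; apply: eq_bigr => i _; rewrite -!sumrB; apply: eq_bigr => k _; ring.
have e1 : \sum_i \sum_(k < n) f i * g i = n%:R * \sum_i f i * g i.
  by rewrite mulr_sumr; apply: eq_bigr => i _; rewrite sumr_const card_ord mulr_natl.
have e2 : \sum_i \sum_k f i * g k = (\sum_i f i) * (\sum_i g i).
  by rewrite mulr_suml; apply: eq_bigr => i _; rewrite mulr_sumr.
have e3 : \sum_i \sum_k f k * g i = (\sum_i f i) * (\sum_i g i).
  by rewrite exchange_big.
have e4 : \sum_(i < n) \sum_k f k * g k = n%:R * \sum_i f i * g i.
  by rewrite sumr_const card_ord mulr_natl.
by rewrite e1 e2 e3 e4; lra.
Qed.

(** Such a function depends only on the gcd with [Q], hence is a function on Z/Q. *)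
Definition gcd_decreasing (Q : nat) (f : nat -> R) :=
  forall n m, (gcdn n Q %| gcdn m Q)%N -> f m <= f n.

Lemma gcd_decreasing_mod (Q : nat) f n : gcd_decreasing Q f -> f (n %% Q)%N = f n.
Proof. by move=> hf; apply/eqP; rewrite eq_le !hf // gcdn_modl. Qed.

Lemma sum_crt (Q1 Q2 : nat) (h : nat -> R) : (0 < Q1)%N -> (0 < Q2)%N -> coprime Q1 Q2 ->
  (forall n, h (n %% (Q1 * Q2))%N = h n) ->
  \sum_(n < Q1 * Q2) h n = \sum_(x < Q1) \sum_(y < Q2) h (chinese Q1 Q2 x y).
Proof.
move=> Q10 Q20 co hh.
pose F (n : 'I_(Q1 * Q2)) : 'I_Q1 * 'I_Q2 :=
  (Ordinal (ltn_pmod n Q10), Ordinal (ltn_pmod n Q20)).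
have injF : injective F.
  move=> n m [h1 h2]; apply: val_inj => /=.
  rewrite -(modn_small (ltn_ord n)) -(modn_small (ltn_ord m)); apply/eqP.
  by rewrite chinese_remainder // h1 h2 !eqxx.
have bijF : bijective F by apply: inj_card_bij; rewrite // card_prod !card_ord.
rewrite pair_big /= (reindex F) /=; last exact: onW_bij.
by apply: eq_bigr => n _; rewrite -[RHS]hh -(chinese_mod co) hh.
Qed.

Lemma dvdn_gcdM (n m Q1 Q2 : nat) : coprime Q1 Q2 ->
  (gcdn n Q1 %| gcdn m Q1)%N -> (gcdn n Q2 %| gcdn m Q2)%N ->
  (gcdn n (Q1 * Q2) %| gcdn m (Q1 * Q2))%N.
Proof.
move=> co h1 h2; apply: dvdn_trans (_ : gcdn m Q1 * gcdn m Q2 %| _)%N.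
  apply: dvdn_trans (dvdn_mul h1 h2); rewrite muln_gcdr dvdn_gcd !muln_gcdl !dvdn_gcd.
  by rewrite !(dvdn_mulr _ (dvdn_gcdl n _)) !(dvdn_mull _ (dvdn_gcdl n _)) dvdn_gcdr.
rewrite dvdn_gcd dvdn_mul ?dvdn_gcdr // andbT Gauss_dvd ?dvdn_gcdl //.
apply: coprime_dvdl (dvdn_gcdr m Q1) _; exact: coprime_dvdr (dvdn_gcdr m Q2) co.
Qed.

(** The sums over the fibres above Z/Q1 are again decreasing, so the first hypothesis applies to
    them; the second is then used within each fibre. *)
Lemma correlation_coprime (Q1 Q2 : nat) : (0 < Q1)%N -> (0 < Q2)%N -> coprime Q1 Q2 ->
  (forall f g, gcd_decreasing Q1 f -> gcd_decreasing Q1 g ->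
    (\sum_(n < Q1) f n) * (\sum_(n < Q1) g n) <= Q1%:R * \sum_(n < Q1) f n * g n) ->
  (forall f g, gcd_decreasing Q2 f -> gcd_decreasing Q2 g ->
    (\sum_(n < Q2) f n) * (\sum_(n < Q2) g n) <= Q2%:R * \sum_(n < Q2) f n * g n) ->
  (forall f g, gcd_decreasing (Q1 * Q2) f -> gcd_decreasing (Q1 * Q2) g ->
    (\sum_(n < Q1 * Q2) f n) * (\sum_(n < Q1 * Q2) g n)
      <= (Q1 * Q2)%:R * \sum_(n < Q1 * Q2) f n * g n).
Proof.
move=> Q10 Q20 co H1 H2 f g hf hg.
have ml x y : gcdn (chinese Q1 Q2 x y) Q1 = gcdn x Q1.
  by rewrite -gcdn_modl chinese_modl // gcdn_modl.
have mr x y : gcdn (chinese Q1 Q2 x y) Q2 = gcdn y Q2.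
  by rewrite -gcdn_modl chinese_modr // gcdn_modl.
have hx (k : nat -> R) (hk : gcd_decreasing (Q1 * Q2) k) x :
    gcd_decreasing Q2 (fun y => k (chinese Q1 Q2 x y)).
  by move=> n m nm; apply: hk; apply: dvdn_gcdM => //; rewrite ?ml ?mr.
have hy (k : nat -> R) (hk : gcd_decreasing (Q1 * Q2) k) :
    gcd_decreasing Q1 (fun x => \sum_(y < Q2) k (chinese Q1 Q2 x y)).
  move=> n m nm; apply: ler_sum => y _.
  by apply: hk; apply: dvdn_gcdM => //; rewrite ?ml ?mr.
have fm n := gcd_decreasing_mod n hf; have gm n := gcd_decreasing_mod n hg.
rewrite (sum_crt (h := f)) // (sum_crt (h := g)) // (sum_crt (h := fun n => f n * g n)) //;
  last by move=> n; rewrite fm gm.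
apply: le_trans (H1 _ _ (hy f hf) (hy g hg)) _.
rewrite natrM -mulrA ler_wpM2l // [leRHS]mulr_sumr; apply: ler_sum => x _.
exact: (H2 _ _ (hx f hf x) (hx g hg x)).
Qed.

(* Functions decreasing along divisibility are positively correlated on Z/Q
   (Harris): on a prime power the gcds form a chain, and coprime factors are
   independent. *)
Lemma correlation (Q : nat) (f g : nat -> R) : (0 < Q)%N ->
  gcd_decreasing Q f -> gcd_decreasing Q g ->
  (\sum_(n < Q) f n) * (\sum_(n < Q) g n) <= Q%:R * \sum_(n < Q) f n * g n.
Proof.
elim/ltn_ind: Q f g => Q IH f g Q0 hf hg; have [Q1|Q1] := eqVneq Q 1%N.
  apply: (chebyshev_sum (f := fun n : 'I_Q => f n)) => i k.
  have -> : i = k by move: i k; rewrite Q1 => i k; rewrite !ord1.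
  by rewrite subrr mul0r.
pose p := pdiv Q; have pp : prime p by rewrite pdiv_prime // ltn_neqAle eq_sym Q1.
have eQ := partnC p Q0; move: hf hg; rewrite -eQ => hf hg.
have co : coprime Q`_p Q`_p^' by exact: coprime_partC.
have Q10 := part_gt0 p Q; have Q20 := part_gt0 p^' Q.
apply: (correlation_coprime Q10 Q20 co) hf hg => {}f {}g hf hg.
  apply: (chebyshev_sum (f := fun n : 'I_(partn Q p) => f n)
    (g := fun n : 'I_(partn Q p) => g n)) => i k.
  have pow (n : nat) : exists a, gcdn n (partn Q p) = (p ^ a)%N.
    have : (gcdn n (partn Q p) %| p ^ logn p Q)%N by rewrite -p_part dvdn_gcdr.
    by case/(dvdn_pfactor _ _ pp) => a _ ha; exists a.
  have [a ha] := pow i; have [b hb] := pow k.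
  have [ab|/ltnW ba] := leqP a b.
    by rewrite mulr_ge0 // subr_ge0 ?hf ?hg // ha hb dvdn_exp2l.
  by rewrite mulr_le0 // subr_le0 ?hf ?hg // ha hb dvdn_exp2l.
apply: IH; rewrite ?part_gt0 // -[X in (_ < X)%N]eQ ltn_Pmull ?part_gt0 //.
rewrite p_part -(exp1n (logn p Q)) ltn_exp2r ?prime_gt1 // logn_gt0.
by rewrite mem_primes pp Q0 pdiv_dvd.
Qed.
End Correlation.

(** * Counting by gcd, and means of periodic sets *)

Lemma big_block (T : Type) (idx : T) (op : Monoid.law idx) (F : nat -> T) (k r : nat) :
  \big[op/idx]_(n < r * k) F n = \big[op/idx]_(m < r) \big[op/idx]_(i < k) F (m * k + i)%N.
Proof.
elim: r => [|r IH]; first by rewrite !big_ord0.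
by rewrite big_ord_recr /= -IH mulSnr big_split_ord.
Qed.

Lemma sum_multiples (V : nmodType) (F : nat -> V) (c n : nat) : (0 < c)%N ->
  \sum_(1 <= k < n.+1 | (c %| k)%N) F k = \sum_(1 <= m < (n %/ c).+1) F (c * m)%N.
Proof.
move=> c0; elim: n => [|n IH]; first by rewrite div0n !big_geq.
rewrite big_mkcond big_nat_recr //= -big_mkcond IH divnS //.
case: (boolP (c %| n.+1)%N) => hc; last by rewrite addr0.
have e := divnK hc; rewrite divnS // hc mulnC in e.
by rewrite add1n [RHS]big_nat_recr //= -add1n e.
Qed.

Lemma totient_mul_prime (p n : nat) : prime p -> (p %| n)%N -> (0 < n)%N ->
  totient (p * n) = (p * totient n)%N.
Proof.
move=> pp pn n0; have [m co e] := pfactor_coprime pp n0.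
have l0 : (0 < logn p n)%N by rewrite logn_gt0 mem_primes pp n0.
rewrite e mulnCA -expnS !totient_coprime ?(coprimeXr, coprime_sym m) //.
rewrite !totient_pfactor //= -{1}(prednK l0) expnS.
by move: (totient m) (p.-1) (p ^ _)%N => a b c; lia.
Qed.

Lemma totient_mul_dvd (k n : nat) : (0 < n)%N -> (k %| n)%N ->
  totient (k * n) = (k * totient n)%N.
Proof.
move=> n0; have [->|k0] := posnP k; first by rewrite !mul0n.
elim/ltn_ind: k k0 => k IH k0 kn; have [->|k1] := eqVneq k 1%N; first by rewrite !mul1n.
have pp : prime (pdiv k) by rewrite pdiv_prime // ltn_neqAle eq_sym k1.
have hp := pdiv_dvd k; have e : (k = pdiv k * (k %/ pdiv k))%N by rewrite mulnC divnK.
have q0 : (0 < k %/ pdiv k)%N by rewrite divn_gt0 ?prime_gt0 // dvdn_leq.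
rewrite {1 2}e -!mulnA totient_mul_prime ?muln_gt0 ?q0 //; last first.
  by rewrite dvdn_mull // (dvdn_trans hp).
rewrite IH ?ltn_Pdiv ?prime_gt1 //.
by apply: dvdn_trans kn; apply/dvdnP; exists (pdiv k).
Qed.

(** With Q = k n, the residues with gcd k are k times the units modulo n. As k divides n, their
    number totient n equals totient Q / k, proportional to 1 / k. *)
Lemma count_gcd_eq (k n : nat) : (0 < n)%N -> (k %| n)%N ->
  (k * \sum_(i < k * n) (gcdn i (k * n) == k) = totient (k * n))%N.
Proof.
move=> n0 kn; rewrite totient_mul_dvd //; congr (_ * _)%N.
have k0 : (0 < k)%N by apply: dvdn_gt0 kn.
rewrite (mulnC k n) (big_block _ (fun i => (gcdn i (n * k) == k)%N : nat)) totient_count_coprime.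
rewrite big_mkord; apply: eq_bigr => m _.
rewrite (bigD1 (Ordinal k0)) //= big1 ?addn0 => [|i hi].
  rewrite [(m * k)%N]mulnC [(n * k)%N]mulnC -muln_gcdr -{2}(muln1 k) eqn_pmul2l //.
  by rewrite coprime_sym.
apply/eqP; rewrite eqb0; apply: contra hi => /eqP h.
have : (k %| m * k + i)%N by rewrite -{1}h dvdn_gcdl.
rewrite dvdn_addr ?dvdn_mull // /dvdn modn_small //.
Qed.

Section Density.
Variable R : realFieldType.

Definition free (S : seq nat) (n : nat) : bool := all (fun s => ~~ (s %| n)%N) S.
Definition mean (f : nat -> bool) (Q : nat) : R := (\sum_(n < Q) (f n)%:R) / Q%:R.
Definition harmonic_sum (n : nat) : R := \sum_(1 <= k < n.+1) k%:R^-1.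
Definition log_count (f : nat -> bool) (n : nat) : R := \sum_(1 <= k < n.+1) (f k)%:R / k%:R.
Definition nat_count (f : nat -> bool) (n : nat) : R := \sum_(1 <= k < n.+1) (f k)%:R.

Lemma mean_ge0 f Q : 0 <= mean f Q.
Proof. by rewrite mulr_ge0 ?invr_ge0 // sumr_ge0. Qed.

Lemma mean_le (f g : nat -> bool) Q : (forall n, f n -> g n) -> mean f Q <= mean g Q.
Proof.
move=> h; rewrite ler_wpM2r ?invr_ge0 //; apply: ler_sum => i _.
by rewrite ler_nat; case: (f i) (h i) => // ->.
Qed.

Lemma free_gcd_decreasing (S : seq nat) (Q : nat) : all (fun s => s %| Q)%N S ->
  gcd_decreasing Q (fun n => (free S n)%:R : R).
Proof.
move=> /allP hS n m hnm; rewrite ler_nat; case: (boolP (free S m)) => // /allP hm.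
suff -> : free S n by [].
apply/allP => s sS; apply: contra (hm s sS) => sn.
by apply: dvdn_trans (dvdn_gcdl m Q); apply: dvdn_trans hnm; rewrite dvdn_gcd sn hS.
Qed.

Lemma mean_free_mul (S T : seq nat) (Q : nat) : (0 < Q)%N ->
  all (fun s => s %| Q)%N S -> all (fun s => s %| Q)%N T ->
  mean (free S) Q * mean (free T) Q <= mean (fun n => free S n && free T n) Q.
Proof.
move=> Q0 hS hT; have q0 : 0 < Q%:R :> R by rewrite ltr0n.
have := correlation Q0 (free_gcd_decreasing hS) (free_gcd_decreasing hT).
rewrite /mean mulrACA -invfM ler_pdivrMr ?mulr_gt0 // mulrA mulfVK ?gt_eqF // mulrC.
by move=> /le_trans; apply; rewrite [X in _ <= X]mulrC ler_wpM2l //; apply: ler_sum => i _;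
  rewrite -natrM mulnb.
Qed.

Definition periodic (Q : nat) (f : nat -> bool) := forall n, f (n + Q)%N = f n.

Lemma periodicM Q f : periodic Q f -> forall m n, f (m * Q + n)%N = f n.
Proof. by move=> h; elim=> // m IH n; rewrite mulSn -addnA addnC h. Qed.

Lemma free_periodic (S : seq nat) (Q : nat) : all (fun s => s %| Q)%N S -> periodic Q (free S).
Proof.
by move=> /allP hS n; apply: eq_in_all => s /hS hs; rewrite dvdn_addl.
Qed.

Lemma mean_mul f Q k : (0 < Q)%N -> (0 < k)%N -> periodic Q f -> mean f (k * Q) = mean f Q.
Proof.
move=> Q0 k0 hf; rewrite /mean (big_block _ (fun n => (f n)%:R)).
rewrite (eq_bigr (fun=> \sum_(i < Q) (f i)%:R)) => [|m _].
  by rewrite sumr_const card_ord -mulr_natl natrM; field; rewrite !pnatr_eq0 -!lt0n k0 Q0.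
by apply: eq_bigr => i _; rewrite periodicM.
Qed.

(** Since k^2 divides [Q], the gcd k occurs exactly totient Q / k times; uniform counting on Z/Q
    thus becomes harmonic counting on [1, x]. *)
Lemma sum_small_gcd (h : nat -> R) (x Q : nat) : (0 < Q)%N ->
  (forall k, (0 < k <= x)%N -> (k * k %| Q)%N) ->
  \sum_(n < Q | (gcdn n Q <= x)%N) h (gcdn n Q)
    = (totient Q)%:R * \sum_(1 <= k < x.+1) h k / k%:R.
Proof.
move=> Q0 hQ.
have e (n : 'I_Q) : (if (gcdn n Q <= x)%N then h (gcdn n Q) else 0)
   = \sum_(1 <= k < x.+1) (gcdn n Q == k)%:R * h k.
  have g0 : (0 < gcdn n Q)%N by rewrite gcdn_gt0 Q0 orbT.
  case: leqP => hx.
    rewrite (bigD1_seq (gcdn n Q)) ?mem_index_iota ?g0 ?iota_uniq //=.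
    by rewrite eqxx mul1r big1 ?addr0 // => k /negbTE; rewrite eq_sym => ->; rewrite mul0r.
  rewrite big_nat big1 // => k /andP[_ kx]; case: eqP => [hk|]; rewrite ?mul0r //.
  by move: hx; rewrite hk ltnNge -ltnS kx.
rewrite big_mkcond (eq_bigr _ (fun n _ => e n)) exchange_big mulr_sumr.
rewrite big_nat [RHS]big_nat; apply: eq_bigr => k /andP[k0 kx].
rewrite -mulr_suml -natr_sum mulrA mulrAC; congr (_ * _).
have hk := hQ k _; rewrite k0 -ltnS kx in hk; have /dvdnP[q hq] := hk isT.
have Qk : (Q = k * (q * k))%N by rewrite hq; lia.
have qk0 : (0 < q * k)%N by move: Q0; rewrite Qk muln_gt0 => /andP[].
have := count_gcd_eq qk0 (dvdn_mull q (dvdnn k)); rewrite -Qk => <-.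
by rewrite natrM mulrAC divff ?mul1r // pnatr_eq0 -lt0n.
Qed.

(* The interval [1, x] is itself closed under divisors, so it is positively
   correlated with freeness from any set. *)
Lemma log_count_free_ge (S : seq nat) (Q x : nat) : (0 < Q)%N ->
  all (fun s => s %| Q)%N S ->
  mean (free S) Q * harmonic_sum x <= log_count (free S) x.
Proof.
(* Passing to this multiple of [Q] keeps the mean and makes k^2 divide the period for every k up to
   [x]. *)
move=> Q0 hS; pose P := (x`! * x`! * Q * Q)%N.
have P0 : (0 < P)%N by rewrite !muln_gt0 fact_gt0 Q0.
have hSP : all (fun s => s %| P)%N S.
  by apply: sub_all hS => s hs; apply: dvdn_mull.
have e1 : mean (free S) P = mean (free S) Q.
  by apply: mean_mul (free_periodic hS) => //; rewrite !muln_gt0 fact_gt0 Q0.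
have hP k : (0 < k <= x)%N -> (k * k %| P)%N.
  by move=> hk; rewrite /P -mulnA dvdn_mulr // dvdn_mul // dvdn_fact.
have hg : gcd_decreasing P (fun n => (gcdn n P <= x)%N%:R : R).
  move=> n m /dvdn_leq h; rewrite ler_nat; case: (leqP (gcdn m P) x) => // hm.
  by rewrite (leq_trans (h _) hm) // gcdn_gt0 P0 orbT.
have hf := free_gcd_decreasing hSP.
have := correlation P0 hf hg.
have sel (h : nat -> R) : \sum_(n < P) h n * (gcdn n P <= x)%N%:R =
    \sum_(n < P | (gcdn n P <= x)%N) h n.
  by rewrite [RHS]big_mkcond; apply: eq_bigr => n _; case: ifP; rewrite ?mulr1 ?mulr0.
rewrite (sel (fun n => (free S n)%:R)).
have -> : \sum_(n < P | (gcdn n P <= x)%N) (free S n)%:R = (totient P)%:R * log_count (free S) x.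
  apply: etrans (sum_small_gcd (fun k => (free S k)%:R) P0 hP); apply: eq_bigr => n _.
  by apply/eqP; rewrite eq_le !hf // -gcdnA gcdnn.
have -> : \sum_(n < P) (gcdn n P <= x)%N%:R = (totient P)%:R * harmonic_sum x.
  rewrite (eq_bigr (fun n : 'I_P => 1 * (gcdn n P <= x)%N%:R)) => [|n _]; last by rewrite mul1r.
  rewrite (sel (fun=> 1)) (sum_small_gcd (fun=> 1)) //; congr (_ * _).
  by apply: eq_bigr => k _; rewrite mul1r.
have t0 : 0 < (totient P)%:R :> R by rewrite ltr0n totient_gt0.
have p0 : 0 < P%:R :> R by rewrite ltr0n.
rewrite mulrCA [X in _ <= X]mulrCA ler_pM2l // -e1 /mean => h.
by rewrite mulrAC ler_pdivrMr // mulrC [leRHS]mulrC mulrC.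
Qed.

Lemma harmonic_sum_le (m n : nat) : (m <= n)%N -> harmonic_sum m <= harmonic_sum n.
Proof.
move=> mn; rewrite /harmonic_sum (big_cat_nat (n := m.+1) (p := n.+1)) //= lerDl.
by apply: sumr_ge0 => i _; rewrite invr_ge0.
Qed.

(** The first period contributes at most [Q]; in each later block, starting at m Q, every reciprocal
    is at most 1 / (m Q). *)
Lemma log_count_periodic_le f Q x : (0 < Q)%N -> periodic Q f ->
  log_count f x <= Q%:R + mean f Q * harmonic_sum x.
Proof.
move=> Q0 hf; pose y := (x %/ Q)%N.
pose F k : R := (f k)%:R / k%:R.
have F0 k : 0 <= F k by rewrite mulr_ge0 ?invr_ge0.
have hx : (x.+1 <= y.+1 * Q)%N by rewrite ltn_ceil.
apply: (@le_trans _ _ (\sum_(k < y.+1 * Q) F k)).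
  rewrite -(big_mkord xpredT F) (big_cat_nat (n := x.+1) (p := (y.+1 * Q)%N)) //=.
  rewrite /log_count [X in _ <= X + _]big_ltn //= addrAC lerDr addr_ge0 ?sumr_ge0 //.
rewrite big_block big_ord_recl; apply: lerD.
  apply: le_trans (_ : \sum_(i < Q) 1 <= _); last by rewrite sumr_const card_ord.
  apply: ler_sum => i _; rewrite /F; case: (f _); rewrite ?mul0r // mul1r.
  (* The block starts at 0, whose inverse is 0 by convention. *)
  have [->|i0] := posnP (0 * Q + i)%N; first by rewrite invr0.
  by rewrite invf_le1 ?ltr0n // ler1n.
apply: (@le_trans _ _ (mean f Q * harmonic_sum y)); last first.
  by rewrite ler_wpM2l ?mean_ge0 // harmonic_sum_le // leq_div.
rewrite /harmonic_sum big_add1 big_mkord mulr_sumr; apply: ler_sum => m _.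
rewrite /mean mulrAC !mulr_suml; apply: ler_sum => i _.
rewrite lift0 /F periodicM // -mulrA -invfM; case: (f i); rewrite ?mul0r //.
rewrite !mul1r lef_pV2 ?posrE -?natrM ?ltr0n ?muln_gt0 ?addn_gt0 ?Q0 //.
by rewrite ler_nat leq_addr.
Qed.

Lemma mean_le1 f Q : mean f Q <= 1.
Proof.
have [->|Q0] := posnP Q; first by rewrite /mean invr0 mulr0.
rewrite ler_pdivrMr ?ltr0n // mul1r; apply: (@le_trans _ _ (\sum_(n < Q) 1)).
  by apply: ler_sum => n _; rewrite lern1 leq_b1.
by rewrite sumr_const card_ord.
Qed.

Lemma sum_periods f Q y : (0 < Q)%N -> periodic Q f ->
  \sum_(k < y * Q) (f k)%:R = mean f Q * (y * Q)%:R.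
Proof.
move=> Q0 hf; have [->|y0] := posnP y; first by rewrite mul0n big_ord0 mulr0.
rewrite -(mean_mul Q0 y0 hf) /mean mulfVK // pnatr_eq0 -lt0n muln_gt0 y0 //.
Qed.

Lemma nat_count_periodic_le f Q x : (0 < Q)%N -> periodic Q f ->
  nat_count f x <= mean f Q * (Q + x)%:R.
Proof.
move=> Q0 hf; have hx : (x.+1 <= (x %/ Q).+1 * Q)%N by rewrite ltn_ceil.
apply: (@le_trans _ _ (\sum_(k < (x %/ Q).+1 * Q) (f k)%:R)).
  rewrite -(big_mkord xpredT (fun k => (f k)%:R)) (big_cat_nat (n := x.+1)) //=.
  by rewrite [X in _ <= X + _]big_ltn //= addrAC lerDr addr_ge0 ?sumr_ge0.
by rewrite sum_periods // ler_wpM2l ?mean_ge0 // ler_nat mulSn leq_add2l leq_trunc_div.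
Qed.

(** The 1 pays for the term at 0, which full periods contain and [nat_count] omits, and [Q] for the
    last incomplete period. *)
Lemma nat_count_periodic_ge f Q x : (0 < Q)%N -> periodic Q f ->
  mean f Q * x%:R <= 1 + Q%:R + nat_count f x.
Proof.
move=> Q0 hf; apply: (@le_trans _ _ (mean f Q * ((x %/ Q) * Q + Q)%:R)).
  by rewrite ler_wpM2l ?mean_ge0 // ler_nat -mulSnr ltnW // ltn_ceil.
rewrite natrD mulrDr -sum_periods // addrAC; apply: lerD; last first.
  by rewrite -[leRHS]mul1r ler_wpM2r // mean_le1.
apply: (@le_trans _ _ (\sum_(k < x.+1) (f k)%:R)).
  rewrite -!(big_mkord xpredT (fun k => (f k)%:R)).
  rewrite [leRHS](big_cat_nat (n := (x %/ Q * Q)%N)) ?leqW ?leq_trunc_div //=.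
  by rewrite lerDl sumr_ge0.
rewrite -(big_mkord xpredT (fun k => (f k)%:R)) big_ltn // lerD2r lern1 leq_b1 //.
Qed.
End Density.

Local Open Scope classical_set_scope.

(** * Reciprocals of primes in a progression *)

Lemma bounded_sum_tail (R : realType) (u : nat -> R) (V : R) :
  (forall k, 0 <= u k) -> (forall n, \sum_(k < n) u k <= V) ->
  forall eps : R, 0 < eps -> exists T, forall n, \sum_(T <= k < n) u k <= eps.
Proof.
move=> u0 uV eps e0; pose E := [set (\sum_(k < n) u k : R) | n in [set: nat]].
have supE : has_sup E.
  split; first by exists (\sum_(k < 0) u k), 0%N.
  by exists V => _ [n _ <-].
have [_ [T _ <-] hT] := sup_adherent e0 supE.
exists T => n; have [nT|Tn] := leqP n T; first by rewrite big_geq // ltW.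
have : \sum_(k < n) u k <= sup E by apply: sup_upper_bound => //; exists n.
rewrite -!(big_mkord xpredT u) in hT *.
rewrite (big_cat_nat (n := T)) ?(ltnW Tn) //=; lra.
Qed.

Lemma sum_inv_sqr (R : realType) (n : nat) : \sum_(k < n) ((k ^ 2)%:R : R)^-1 <= 2.
Proof.
(* This sharper bound telescopes, as 1 / (x + 1)^2 <= 1 / x - 1 / (x + 1); the term at 0 is 0. *)
suff h : \sum_(k < n.+2) ((k ^ 2)%:R : R)^-1 <= 2 - (n.+1)%:R^-1.
  apply: (@le_trans _ _ (\sum_(k < n.+2) ((k ^ 2)%:R : R)^-1)).
    rewrite !big_ord_recr /= -addrA lerDl addr_ge0 // invr_ge0 ler0n //.
  by apply: le_trans h _; rewrite gerBl invr_ge0.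
elim: n => [|n IH].
  by rewrite !big_ord_recr big_ord0 /= invr0 !invr1; lra.
rewrite big_ord_recr /=; apply: le_trans (lerD IH (lexx _)) _.
rewrite -addrA lerD2l natrX; set x : R := n.+1%:R.
have -> : n.+2%:R = x + 1 :> R by rewrite /x -natr1.
have x0 : 0 < x by rewrite ltr0n.
have -> : - x^-1 + ((x + 1) ^+ 2)^-1 = - (x + 1)^-1 - (x * (x + 1) ^+ 2)^-1.
  by field; rewrite ?gt_eqF //; lra.
by rewrite gerBl invr_ge0 mulr_ge0 ?sqr_ge0 // ltW.
Qed.

Lemma sum_lt_minn (n T : nat) : (\sum_(k < n) (k < T) = minn n T)%N.
Proof. by elim: n => [|n IH]; rewrite ?big_ord0 ?min0n // big_ord_recr /= IH; lia. Qed.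

Section Divergence.
Variables (R : realType) (j : nat).

Let d := (2 ^ j)%N.
Let in_class (p : nat) := prime p && (p == 2 ^ j.+1 + 1 %[mod 2 ^ j.+2])%N.
(** Up to a constant factor and a boundary term, this bounds the proportion of box points with norm
    divisible by p. *)
Let u (p : nat) : R := if good_prime j p then (prime_weight j p)%:R^-1 else 0.

Let u_ge0 p : 0 <= u p.
Proof. by rewrite /u; case: ifP => // _; rewrite invr_ge0. Qed.

Let u_sum (V : R) : (forall n, \sum_(p < n | in_class p) (p%:R : R)^-1 <= V) ->
  forall n, \sum_(p < n) u p <= V + 2.
Proof.
move=> hV n; apply: le_trans (lerD (hV n) (sum_inv_sqr R n)).
rewrite [X in _ <= X + _]big_mkcond -big_split /=; apply: ler_sum => p _.
rewrite /u; case: ifP => [/and3P[pp _ _]|_].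
  by rewrite /prime_weight /in_class pp /=; case: ifP => _; rewrite ?lerDl ?lerDr ?invr_ge0.
by rewrite addr_ge0 //; case: ifP => // _; rewrite invr_ge0.
Qed.

Let card_box_le (m Y : nat) (p : nat) :
  good_prime j p -> ~~ (p%:Z %| (2 ^ j.+2 * m)%N%:Z)%Z ->
  #|[set b : {ffun 'I_d -> 'I_Y} | (p%:Z %| tower_norm j (box_point m b))%Z]%SET|%:R
    <= (2 * d)%:R * ((2 * d * Y) ^ d)%:R * u p + (2 * d)%:R.
Proof.
move=> gp hM; have hw := prime_weightP gp; have /and3P[pp op hp] := gp.
have := card_box_dvd Y (1 + (2 * m%:Z) *: geom_poly (2 ^ j)) pp op hM hw.
rewrite -(ler_nat R) natrM [X in _ <= X -> _]natrM natrD [X in _ <= X%:R * _]expnS -/d /u gp.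
have w0 : 0 < (prime_weight j p)%:R :> R.
  by rewrite ltr0n /prime_weight; case: ifP; rewrite ?expn_gt0 prime_gt0.
rewrite -ler_pdivlMr // => /le_trans; apply.
rewrite mulrDr mulrDl -!mulrA divff ?mulr1 ?gt_eqF //.
Qed.

Lemma sum_inv_progression_unbounded (V : R) :
  exists n, V < \sum_(p < n | prime p && (p == 2 ^ j.+1 + 1 %[mod 2 ^ j.+2])%N) (p%:R)^-1.
Proof.
apply: contrapT => /forallNP hV.
have {}hV n : \sum_(p < n | in_class p) (p%:R : R)^-1 <= V.
  by rewrite leNgt; apply/negP; exact: hV.
have tail := bounded_sum_tail u_ge0 (u_sum hV).
have d0 : (0 < d)%N by rewrite expn_gt0.
have dR : 1 <= d%:R :> R by rewrite ler1n.
pose C : R := ((2 * d) ^ d)%:R.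
have C0 : 0 < C by rewrite ltr0n expn_gt0 muln_gt0 d0.
(* With X = Y^d, the main terms of all p > T then add up to at most 2 d C X / (8 d C) = X / 4. *)
have e1 : 0 < (8 * d%:R * C)^-1 by rewrite invr_gt0 !mulr_gt0 //; lra.
have [T hT] := tail _ e1.
pose m := (\prod_(p < T.+1 | prime p && odd p) p)%N.
have om : odd m by rewrite /m; elim/big_ind: _ => // [x y|p /andP[]//]; rewrite oddM => -> ->.
have m0 : (0 < m)%N by case: (m) om.
have hm p : prime p -> odd p -> (p <= T)%N -> (p %| m)%N.
  move=> pp op pT; rewrite /m (bigD1 (Ordinal (pT : p < T.+1)%N)) /= ?pp ?op //.
  exact: dvdn_mulr.
have hm' p : prime p -> odd p -> (T < p)%N -> ~~ (p%:Z %| (2 ^ j.+2 * m)%N%:Z)%Z.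
  move=> pp op Tp; rewrite dvdzE /= Euclid_dvdM // negb_or Euclid_dvdX // andbT.
  rewrite dvdn_prime2 //; apply/andP; split; first by apply: contraTneq op => ->.
  rewrite /m; elim/big_ind: _ => [|x y hx hy|q /andP[pq _]].
  - by rewrite dvdn1; apply: contraTneq pp => ->.
  - by rewrite Euclid_dvdM // negb_or hx.
  rewrite dvdn_prime2 //; apply: contraTneq Tp => ->.
  by rewrite -leqNgt -ltnS ltn_ord.
(* The norms in the box are at most Z = D Y^d. Since [D] does not involve [Y], the threshold [T2]
   can be fixed before [Y]. *)
pose D := ((7 * d * d * m) ^ d)%N.
have D0 : (0 < D)%N by rewrite expn_gt0 !muln_gt0 d0 m0.
have D1 : 1 <= D%:R :> R by rewrite ler1n.
have e2 : 0 < (8 * d%:R * D%:R)^-1 :> R by rewrite invr_gt0 !mulr_gt0 //; lra.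
have [T2 hT2] := tail _ e2.
(* This makes 2 d T2 < X / 2. The boundary terms are then below X / 2 + X / 4, and with the main
   terms the total stays below X. *)
pose Y := (4 * d * T2).+1.
pose Z := ((7 * d * d * m * Y) ^ d)%N.
have hZ : Z = (D * Y ^ d)%N by rewrite /Z expnMn.
pose P p := [&& (T < p)%N, good_prime j p & (prime_weight j p <= Z)%N].
have hcount : (Y ^ d)%:R <= \sum_(p < Z.+1 | P p)
    ((2 * d)%:R * ((2 * d * Y) ^ d)%:R * u p + (2 * d)%:R) :> R.
  have := @box_count j m T Y om hm; rewrite -/d -/Z -(ler_nat R) natr_sum => /le_trans; apply.
  apply: ler_sum => p /and3P[Tp gp _]; apply: card_box_le => //.
  by case/and3P: gp => pp op _; exact: hm'.
have hsum1 : \sum_(p < Z.+1 | P p) u p <= (8 * d%:R * C)^-1.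
  apply: le_trans (hT Z.+1); rewrite (big_nat_widenl _ 0%N) // big_mkord.
  rewrite big_mkcond [X in _ <= X]big_mkcond /=; apply: ler_sum => p _.
  by rewrite /P; case: (ltnP T p) => [/ltnW ->|_] /=; case: ifP => // _.
(* The number of admissible p: at most [T2] of them lie below [T2], and for the others a weight of
   at most [Z] gives 1 <= Z u(p), so the tail bound applies. *)
have hsum2 : (\sum_(p < Z.+1 | P p) 1 : R) <= T2%:R + Z%:R * (8 * d%:R * D%:R)^-1.
  apply: (@le_trans _ _ (T2%:R + \sum_(T2 <= p < Z.+1) Z%:R * u p)); last first.
    by rewrite -mulr_sumr lerD2l ler_wpM2l.
  rewrite (big_nat_widenl _ 0%N) // big_mkord.
  apply: (@le_trans _ _ (\sum_(p < Z.+1) (((p < T2)%N : nat)%:R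
     + (if (T2 <= p)%N then Z%:R * u p else 0)))).
    rewrite big_mkcond; apply: ler_sum => p _; rewrite /P.
    case: ifP => [/and3P[_ gp wZ]|_]; last first.
      by rewrite addr_ge0 //; case: ifP => // _; rewrite mulr_ge0.
    case: ltnP => // _; first by rewrite addr0.
    rewrite add0r /u gp ler_pdivlMr ?mul1r ?ler_nat //.
    have /and3P[/prime_gt0 p0 _ _] := gp.
    by rewrite ltr0n /prime_weight; case: ifP; rewrite ?expn_gt0 ?p0.
  rewrite big_split /= -natr_sum sum_lt_minn [X in _ <= _ + X]big_mkcond /= lerD2r ler_nat.
  exact: geq_minr.
move: hcount; apply/negP; rewrite -ltNge big_split /= -mulr_sumr.
rewrite [X in _ + X](_ : _ = (2 * d)%:R * \sum_(p < Z.+1 | P p) 1); last first.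
  by rewrite mulr_sumr; apply: eq_bigr => p _; rewrite mulr1.
set X : R := (Y ^ d)%:R.
have X0 : 4 * d%:R * T2%:R + 1 <= X.
  apply: (@le_trans _ _ (Y%:R)); first by rewrite /Y -[leRHS]natr1 !natrM.
  by rewrite ler_nat -{1}(expn1 Y) leq_pexp2l.
have -> : ((2 * d * Y) ^ d)%:R = C * X by rewrite -natrM -expnMn.
have h1 : (2 * d)%:R * (C * X) * (\sum_(p < Z.+1 | P p) u p) <= X / 4.
  apply: le_trans (ler_wpM2l _ hsum1) _; first by rewrite !mulr_ge0 //; lra.
  rewrite natrM le_eqVlt; apply/orP; left; apply/eqP; field.
  by rewrite !gt_eqF //; lra.
have h2 : (2 * d)%:R * (\sum_(p < Z.+1 | P p) 1 : R) <= 2 * d%:R * T2%:R + X / 4.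
  apply: le_trans (ler_wpM2l _ hsum2) _; first by rewrite ler0n.
  rewrite hZ !natrM -/X le_eqVlt; apply/orP; left; apply/eqP; field.
  by rewrite !gt_eqF //; lra.
apply: le_lt_trans (lerD h1 h2) _; lra.
Qed.
End Divergence.

(** * Logarithmic density and Behrend sets *)

Lemma mem_multiples (B : set nat) (k : nat) :
  reflect (exists2 b, B b & (b %| k)%N) (k%:Z \in multiples B).
Proof.
apply: (iffP idP); first by rewrite inE => -[b Bb /= bk]; exists b.
by case=> b Bb bk; rewrite inE; exists b.
Qed.

Section LogDensity.
Variable R : realType.

Lemma log_averageE (A : set int) (n : nat) :
  log_average R A n = log_count R (fun k => k%:Z \in A) n / ln n%:R.
Proof.
rewrite /log_average /log_count big_mkcond; congr (_ / _); apply: eq_bigr => k _.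
by case: ifP; rewrite ?mul1r ?mul0r.
Qed.

Lemma natural_averageE (A : set int) (n : nat) :
  natural_average R A n = nat_count R (fun k => k%:Z \in A) n / n%:R.
Proof.
rewrite /natural_average /nat_count -sum1_count natr_sum.
have -> : iota 1 n = index_iota 1 n.+1 by rewrite /index_iota subn1.
rewrite big_mkcond; congr (_ / _).
by apply: eq_bigr => k _; case: (_ \in _).
Qed.

Lemma log_countC (f : nat -> bool) (n : nat) :
  log_count R f n + log_count R (fun k => ~~ f k) n = harmonic_sum R n.
Proof.
rewrite -big_split; apply: eq_bigr => k _ /=.
by case: (f k); rewrite ?mul1r ?mul0r ?addr0 ?add0r.
Qed.

Lemma log_count_le (f g : nat -> bool) n :
  (forall k, (0 < k <= n)%N -> f k -> g k) -> log_count R f n <= log_count R g n.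
Proof.
move=> h; rewrite /log_count big_nat [leRHS]big_nat; apply: ler_sum => k hk.
by rewrite ler_wpM2r ?invr_ge0 // ler_nat; case: (f k) (h k hk) => // ->.
Qed.

Lemma log_count_ge0 f n : 0 <= log_count R f n.
Proof. by apply: sumr_ge0 => k _; rewrite mulr_ge0 ?invr_ge0. Qed.

Lemma ln_le_harmonic (n : nat) : ln n.+1%:R <= harmonic_sum R n.+1.
Proof.
apply: le_trans (harmonic_sum_le R (leqnSn n)).
elim: n => [|n IH]; first by rewrite /harmonic_sum big_geq // ln1.
rewrite /harmonic_sum big_nat_recr //= -/(harmonic_sum R n).
have n0 : 0 < n.+1%:R :> R by rewrite ltr0n.
have -> : n.+2%:R = n.+1%:R * (1 + n.+1%:R^-1) :> R.
  by rewrite mulrDr mulr1 divff ?gt_eqF // natr1.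
have i0 : 0 < n.+1%:R^-1 :> R by rewrite invr_gt0.
rewrite lnM ?posrE ?addr_gt0 //; apply: lerD IH _.
by apply: le_ln1Dx; exact: lt_trans (ltrN10 _) i0.
Qed.

Lemma harmonic_le_ln (n : nat) : harmonic_sum R n.+1 <= 1 + ln n.+1%:R.
Proof.
elim: n => [|n IH]; first by rewrite /harmonic_sum big_nat1 invr1 ln1 addr0.
rewrite /harmonic_sum big_nat_recr //= -/(harmonic_sum R n.+1).
have n0 : 0 < n.+1%:R :> R by rewrite ltr0n.
have n1 : 0 < n.+2%:R :> R by rewrite ltr0n.
have i1 : n.+2%:R^-1 < 1 :> R by rewrite invf_lt1 // ltr1n.
have e : n.+1%:R = n.+2%:R * (1 + - n.+2%:R^-1) :> R.
  by rewrite mulrDr mulr1 mulrN divff ?gt_eqF // -[n.+2%:R]natr1 addrK.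
have h : ln n.+1%:R <= ln n.+2%:R - n.+2%:R^-1 :> R.
  have p1 : 0 < 1 + - n.+2%:R^-1 :> R by rewrite subr_gt0.
  rewrite [in leLHS]e lnM ?posrE // lerD2l.
  by apply: le_ln1Dx; rewrite ltrN2.
by apply: le_trans (lerD IH (lexx _)) _; rewrite -addrA lerD2l -lerBrDr.
Qed.

Lemma ln_nat_large (M : R) : exists N, forall n, (N <= n)%N -> M <= ln n%:R.
Proof.
have [N hN] : exists N : nat, expR M <= N%:R.
  by exists (Num.truncn (expR M)).+1; rewrite ltW // truncnS_gt.
exists N => n Nn; rewrite -[leLHS]expRK ler_ln ?posrE ?expR_gt0 //.
  by apply: le_trans hN _; rewrite ler_nat.
by apply: lt_le_trans (expR_gt0 M) _; apply: le_trans hN _; rewrite ler_nat.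
Qed.

(** A finitary substitute for the Behrend property, free of limits; [mean R (free S) Q] is the
    density of the integers free from [S]. *)
Definition almost_covering (A : set nat) := forall eps : R, 0 < eps ->
  exists S : seq nat, exists Q : nat,
    [/\ (0 < Q)%N, all (fun s => s %| Q)%N S, forall s, s \in S -> A s
      & mean R (free S) Q < eps].

Lemma almost_covering_log_count (A : set nat) (eps : R) : almost_covering A -> 0 < eps ->
  exists C : R, forall n,
    log_count R (fun k => k%:Z \notin multiples A) n <= C + eps * harmonic_sum R n.
Proof.
move=> hA e0; have [S [Q [Q0 SQ SA hm]]] := hA _ e0.
exists Q%:R => n; apply: (@le_trans _ _ (log_count R (free S) n)).
  apply: log_count_le => k _ hk; apply/allP => s sS; apply: contra hk => sk.
  by apply/mem_multiples; exists s => //; apply: SA.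
apply: le_trans (log_count_periodic_le R n Q0 (free_periodic SQ)) _.
by rewrite lerD2l ler_wpM2r ?(ltW hm) // sumr_ge0 // => k _; rewrite invr_ge0.
Qed.

Lemma almost_covering_nat_count (A : set nat) (eps : R) : almost_covering A -> 0 < eps ->
  exists C : R, forall n,
    nat_count R (fun k => k%:Z \notin multiples A) n <= C + eps * n%:R.
Proof.
move=> hA e0; have [S [Q [Q0 SQ SA hm]]] := hA _ e0.
exists (eps * Q%:R) => n; apply: (@le_trans _ _ (nat_count R (free S) n)).
  apply: ler_sum => k _; rewrite ler_nat; case: (boolP (_ \notin _)) => // hk.
  suff -> : free S k by [].
  apply/allP => s sS; apply: contra hk => sk.
  by apply/mem_multiples; exists s => //; apply: SA.
apply: le_trans (nat_count_periodic_le R n Q0 (free_periodic SQ)) _.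
by rewrite -mulrDr -natrD ler_wpM2r ?(ltW hm).
Qed.

(** Used for both densities, with [w] the logarithm or the identity. *)
Lemma cvg_quotient (w u : nat -> R) (l : R) :
  (forall M : R, exists N, forall n, (N <= n)%N -> M <= w n) ->
  (forall eps, 0 < eps -> exists C : R, forall n, (0 < n)%N ->
     `|l * w n - u n| <= C + eps * w n) ->
  (u n / w n) @[n --> \oo] --> l.
Proof.
move=> hw h; apply/cvgrPdist_le => eps e0.
have e20 : 0 < eps / 2 by lra.
have [C hC] := h _ e20.
(* Beyond this bound w is positive and C <= (eps / 2) w. *)
have [N hN] := hw (Num.max 1 (2 * C / eps)).
exists (maxn N 1) => // n /=; rewrite geq_max => /andP[Nn n0].
have := hN n Nn; rewrite ge_max => /andP[l1 l2].
have l0 : 0 < w n by lra.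
have -> : l - u n / w n = (l * w n - u n) / w n.
  by rewrite mulrBl mulfK // gt_eqF.
rewrite normrM normfV (gtr0_norm l0) ler_pdivrMr //.
apply: le_trans (hC n n0) _; move: l2; rewrite ler_pdivrMr //; lra.
Qed.

(** Only elements of [A] up to n matter for integers up to n. If finite subsets always leave density
    at least eps, [log_count_free_ge] leaves a logarithmic share eps uncovered for every n. *)
Lemma behrend_almost_covering (A : set nat) : behrend R A -> almost_covering A.
Proof.
case=> A1 hA; apply: contrapT => /existsNP[eps /not_implyP[e0 hno]].
have low n : eps * harmonic_sum R n <= log_count R (fun k => k%:Z \notin multiples A) n.
  pose S := [seq a <- iota 1 n | a \in A].
  have SQ : all (fun s => s %| n`!)%N S.
    by apply/allP => s; rewrite mem_filter mem_iota add1n => /andP[_]; exact: dvdn_fact.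
  have hm : eps <= mean R (free S) n`!.
    rewrite leNgt; apply/negP => hm; apply: hno; exists S, n`!.
    split; rewrite ?fact_gt0 // => s.
    by rewrite mem_filter => /andP[/set_mem].
  apply: (@le_trans _ _ (log_count R (free S) n)).
    apply: le_trans (log_count_free_ge R n (fact_gt0 n) SQ).
    by rewrite ler_wpM2r // sumr_ge0 // => k _; rewrite invr_ge0.
  apply: log_count_le => k /andP[k0 kn] /allP hf; apply/negP => /mem_multiples[a Aa ak].
  have aS : a \in S.
    rewrite mem_filter mem_set // mem_iota add1n ltnS.
    by rewrite (leq_trans (dvdn_leq k0 ak)) // (ltnW (A1 a Aa)).
  by have := hf a aS; rewrite ak.
(* The value 1 differs from the default value 0 of [limn], so the averages really converge. *)
have hc : log_average R (multiples A) n @[n --> \oo] --> (1 : R).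
  by rewrite -hA; apply: cvgNpoint; rewrite -/(log_density _ _) hA oner_neq0.
have e20 : 0 < eps / 2 by lra.
move/cvgrPdist_le/(_ _ e20) : hc => [N1 _ hN1].
(* The estimates below give eps ln n <= 1 + (eps / 2) ln n, that is ln n <= 2 / eps. *)
have [N2 hN2] := ln_nat_large (2 / eps + 1).
pose n := (maxn N1 N2).+1.
have := hN1 n; rewrite /= -/n leqW ?leq_maxl // => /(_ isT).
have hl : 2 / eps + 1 <= ln n%:R by apply: hN2; rewrite leqW // leq_maxr.
have i0 : 0 < 2 / eps by rewrite divr_gt0.
have l0 : 0 < ln n%:R :> R by lra.
move=> /(le_trans (ler_norm _)); rewrite log_averageE lerBlDr.
rewrite -lerBlDl ler_pdivlMr // => h.
have := log_countC (fun k => k%:Z \in multiples A) n.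
have := harmonic_le_ln (maxn N1 N2); have := ln_le_harmonic (maxn N1 N2); rewrite -/n => h1 h2 h3.
have h4 : eps * ln n%:R <= eps * harmonic_sum R n by rewrite ler_pM2l.
have h5 : 2 + eps <= eps * ln n%:R.
  have -> : 2 + eps = eps * (2 / eps + 1).
    by rewrite mulrDr mulr1 mulrCA divff ?gt_eqF // mulr1.
  by rewrite ler_pM2l.
have := low n; lra.
Qed.

Lemma almost_covering_behrend (A : set nat) : A `<=` [set n | (1 < n)%N] ->
  almost_covering A -> behrend R A.
Proof.
move=> A1 hA; split=> //; apply/cvg_lim => //.
rewrite (_ : log_average R (multiples A) =
  (fun n => log_count R (fun k => k%:Z \in multiples A) n / ln n%:R)); last first.
  by apply/funext => n; rewrite log_averageE.
apply: (cvg_quotient ln_nat_large) => eps e0; have [C hC] := almost_covering_log_count hA e0.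
exists (1 + `|C| + eps) => -[//|n] _; rewrite mul1r.
have := hC n.+1; have := log_countC (fun k => k%:Z \in multiples A) n.+1.
have := harmonic_le_ln n; have := ln_le_harmonic n.
have := log_count_ge0 (fun k => k%:Z \notin multiples A) n.+1.
have := ler_norm C.
set H := harmonic_sum _ _; set L := ln _ => h1 h2 h3 h4 h5 h6.
have h7 : eps * H <= eps * (1 + L) by rewrite ler_pM2l.
have l0 : 0 <= L by rewrite ln_ge0 // ler1n.
have h8 : 0 <= eps * L by rewrite mulr_ge0 // ltW.
by rewrite ler_norml; lra.
Qed.

(** If finite subsets of [A1] and [A2] always leave densities at least e1 and e2, then by positive
    correlation a density of at least e1 e2 is free from both, hence from [A]. *)
Lemma almost_covering_split (A A1 A2 : set nat) :
  (forall a, A a -> (exists2 b, A1 b & (b %| a)%N) \/ (exists2 b, A2 b & (b %| a)%N)) ->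
  almost_covering A -> almost_covering A1 \/ almost_covering A2.
Proof.
move=> cov hA; apply: contrapT => /not_orP[].
move=> /existsNP[e1 /not_implyP[e10 h1]] /existsNP[e2 /not_implyP[e20 h2]].
have [S [Q [Q0 SQ SA hm]]] := hA _ (mulr_gt0 e10 e20).
(* All elements of B dividing [Q], so that one period serves both sets. *)
pose T (B : set nat) := [seq b <- iota 1 Q | (b \in B) && (b %| Q)%N].
have TQ B : all (fun s => s %| Q)%N (T B).
  by apply/allP => b; rewrite mem_filter => /andP[/andP[]].
have TB B b : b \in T B -> B b by rewrite mem_filter => /andP[/andP[/set_mem]].
have big (B : set nat) (e : R) : ~ (exists S Q, [/\ (0 < Q)%N, all (fun s => s %| Q)%N S,
     forall s, s \in S -> B s & mean R (free S) Q < e]) -> e <= mean R (free (T B)) Q.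
  by move=> h; rewrite leNgt; apply/negP => hl; apply: h; exists (T B), Q; split => //; exact: TB.
have inT (B : set nat) a b : a \in S -> B b -> (b %| a)%N -> b \in T B.
  move=> aS Bb ba; have bQ := dvdn_trans ba (allP SQ a aS).
  by rewrite mem_filter mem_set //= bQ mem_iota add1n ltnS (dvdn_gt0 Q0 bQ) dvdn_leq.
move: hm; apply/negP; rewrite -leNgt.
apply: (@le_trans _ _ (mean R (free (T A1)) Q * mean R (free (T A2)) Q)).
  by apply: ler_pM; rewrite ?(ltW e10) ?(ltW e20) //; apply: big.
apply: le_trans (mean_free_mul R Q0 (TQ A1) (TQ A2)) _; apply: mean_le => n.
move=> /andP[/allP f1 /allP f2]; apply/allP => a aS; apply/negP => an.
case: (cov a (SA a aS)) => -[b Bb ba].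
  by have := f1 b (inT _ _ _ aS Bb ba); rewrite (dvdn_trans ba an).
by have := f2 b (inT _ _ _ aS Bb ba); rewrite (dvdn_trans ba an).
Qed.

(** The integers that are 1 modulo [a] stay free and have density 1 / a. The inclusion also covers
    the empty set. *)
Lemma not_almost_covering_sub1 (a : nat) (A : set nat) : (1 < a)%N -> A `<=` [set a] ->
  ~ almost_covering A.
Proof.
move=> a1 Aa hA; have a0 : 0 < a%:R :> R by rewrite ltr0n ltnW.
have i0 : 0 < a%:R^-1 :> R by rewrite invr_gt0.
have [S [Q [Q0 SQ SA]]] := hA _ i0; apply/negP; rewrite -leNgt.
rewrite -(mean_mul R Q0 (ltnW a1) (free_periodic SQ)) mulnC /mean.
have q0 : 0 < Q%:R :> R by rewrite ltr0n.
rewrite (big_block _ (fun n => (free S n)%:R)) ler_pdivlMr ?natrM ?mulr_gt0 //.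
rewrite mulrCA mulVf ?gt_eqF // mulr1 -[Q in leLHS]card_ord -sumr_const.
apply: ler_sum => m _; rewrite (bigD1 (Ordinal a1)) //=.
have -> : free S (m * a + 1)%N.
  apply/allP => s /SA /Aa ->; rewrite dvdn_addr ?dvdn_mull // dvdn1.
  by rewrite gtn_eqF.
by rewrite lerDl sumr_ge0.
Qed.

Lemma almost_coveringD1 (a : nat) (A : set nat) : (1 < a)%N ->
  almost_covering A -> almost_covering (A `\ a).
Proof.
move=> a1 hA; have cov b : A b -> (exists2 c, (A `\ a) c & (c %| b)%N) \/
    (exists2 c, [set a] c & (c %| b)%N).
  move=> Ab; have [->|ba] := eqVneq b a; first by right; exists a.
  by left; exists b => //; split=> //= e; rewrite e eqxx in ba.
case: (almost_covering_split cov hA) => // h.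
by case: (not_almost_covering_sub1 a1 _ h).
Qed.

Lemma log_count_dilate (c : nat) (g : nat -> bool) n : (0 < c)%N ->
  log_count R (fun k => (c %| k)%N && g (k %/ c)%N) n <= log_count R g n.
Proof.
move=> c0; apply: (@le_trans _ _ (\sum_(1 <= k < n.+1 | (c %| k)%N) (g (k %/ c)%N)%:R / k%:R)).
  by rewrite [leRHS]big_mkcond; apply: ler_sum => k _; case: (_ %| _)%N; rewrite ?mul0r.
rewrite (sum_multiples (fun k => (g (k %/ c)%N)%:R / k%:R)) //.
apply: (@le_trans _ _ (log_count R g (n %/ c))).
  rewrite /log_count big_nat [leRHS]big_nat; apply: ler_sum => k /andP[k0 _].
  rewrite mulKn // ler_wpM2l // lef_pV2 ?posrE ?ltr0n ?muln_gt0 ?c0 //.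
  by rewrite ler_nat leq_pmull.
rewrite [leRHS]/log_count (big_cat_nat (n := (n %/ c).+1)) //=; last by rewrite ltnS leq_div.
by rewrite lerDl sumr_ge0 // => k _; rewrite mulr_ge0 ?invr_ge0.
Qed.

Lemma nat_count_dilate (c : nat) (g : nat -> bool) n : (0 < c)%N ->
  nat_count R (fun k => (c %| k)%N && g (k %/ c)%N) n <= nat_count R g n.
Proof.
move=> c0; apply: (@le_trans _ _ (\sum_(1 <= k < n.+1 | (c %| k)%N) (g (k %/ c)%N)%:R)).
  by rewrite [leRHS]big_mkcond; apply: ler_sum => k _; case: (_ %| _)%N.
rewrite (sum_multiples (fun k => (g (k %/ c)%N)%:R)) //.
apply: (@le_trans _ _ (nat_count R g (n %/ c))).
  by apply: ler_sum => k _; rewrite mulKn.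
rewrite [leRHS]/nat_count (big_cat_nat (n := (n %/ c).+1)) //=; last by rewrite ltnS leq_div.
by rewrite lerDl sumr_ge0.
Qed.

(* If both sequences diverge, both limits are the default value. *)
Lemma limn_eq (u v : nat -> R) : (u n - v n) @[n --> \oo] --> (0 : R) -> limn u = limn v.
Proof.
move=> h; suff e : [set l : R | u n @[n --> \oo] --> l] = [set l : R | v n @[n --> \oo] --> l].
  exact: (congr1 (xget point) e).
apply/seteqP; split=> l /= hl.
  have -> : v = (fun n => u n - (u n - v n)) by apply/funext => n; rewrite opprB addrCA subrr addr0.
  by rewrite -[l]subr0; apply: cvgB.
have -> : u = (fun n => v n + (u n - v n)) by apply/funext => n; rewrite addrCA subrr addr0.
by rewrite -[l]addr0; apply: cvgD.
Qed.

(** The two sets of multiples differ only in c times integers that are not multiples of [A'], a set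
    of logarithmic density 0. *)
Lemma log_density_eq (A B A' : set nat) (c : nat) : (0 < c)%N -> almost_covering A' ->
  (forall k : nat, k%:Z \in multiples B -> k%:Z \in multiples A) ->
  (forall k : nat, k%:Z \in multiples A -> k%:Z \notin multiples B ->
     (c %| k)%N && ((k %/ c)%N%:Z \notin multiples A')) ->
  log_density R (multiples A) = log_density R (multiples B).
Proof.
move=> c0 hA' BA AB; apply: limn_eq.
pose d n := log_count R (fun k => (k%:Z \in multiples A) && (k%:Z \notin multiples B)) n.
rewrite (_ : (fun n => _) = (fun n => d n / ln n%:R)); last first.
  apply/funext => n; rewrite !log_averageE -mulrBl; congr (_ / _).
  rewrite /log_count -sumrB; apply: eq_bigr => k _; rewrite -mulrBl; congr (_ / _).
  by have := BA k; do 2!case: (_ \in _) => //=; rewrite ?subr0 ?subrr // => /(_ isT).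
apply: (cvg_quotient ln_nat_large) => eps e0; have [C hC] := almost_covering_log_count hA' e0.
exists (`|C| + eps) => -[//|n] _; rewrite mul0r sub0r normrN ger0_norm ?log_count_ge0 //.
apply: (@le_trans _ _ (log_count R (fun k => k%:Z \notin multiples A') n.+1)).
  apply: le_trans (log_count_dilate (fun k => k%:Z \notin multiples A') n.+1 c0).
  by apply: log_count_le => k _ /andP[]; exact: AB.
apply: le_trans (hC n.+1) _; have h1 := ler_norm C.
have h2 : eps * harmonic_sum R n.+1 <= eps * (1 + ln n.+1%:R).
  by rewrite ler_pM2l // harmonic_le_ln.
by rewrite mulrDr mulr1 in h2; lra.
Qed.

(** Removing c a from [E] loses only multiples of c whose quotient by c is no multiple of A minus a.
    That set is still almost covering, so the logarithmic density does not drop. *)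
Lemma taut_no_dilate (E A : set nat) (c : nat) : taut R E -> (0 < c)%N ->
  A `<=` [set n | (1 < n)%N] -> almost_covering A -> dilate c A `<=` E -> False.
Proof.
move=> hE c0 A1 hA cAE.
have [a Aa] : exists a, A a.
  apply: contrapT => /forallNP A0; apply: (@not_almost_covering_sub1 2 A) => // a Aa.
  by case: (A0 a).
have Eb : E (c * a)%N by apply: cAE; exists a.
have := hE _ Eb; rewrite (@log_density_eq E (E `\ (c * a)%N) (A `\ a) c) ?ltxx //.
- exact: almost_coveringD1 (A1 a Aa) hA.
- by move=> k /mem_multiples[b [Eb' _] bk]; apply/mem_multiples; exists b.
move=> k /mem_multiples[b Eb' bk] hk.
have e : b = (c * a)%N.
  by apply: contrapT => hb; case/negP: hk; apply/mem_multiples; exists b.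
have ck : (c %| k)%N by apply: dvdn_trans bk; rewrite e dvdn_mulr.
rewrite ck /=; apply/negP => /mem_multiples[a' [Aa' na'] a'k]; case/negP: hk.
apply/mem_multiples; exists (c * a')%N; last by rewrite -(divnK ck) mulnC dvdn_pmul2r.
split; first by apply: cAE; exists a'.
by move=> /= /eqP; rewrite eqn_pmul2l // => /eqP.
Qed.

Lemma taut_primitive (E : set nat) (a b : nat) : taut R E -> E a -> E b -> (a %| b)%N -> a = b.
Proof.
move=> hE Ea Eb ab; apply: contrapT => nab; have := hE _ Eb.
suff -> : multiples (E `\ b) = multiples E by rewrite ltxx.
apply/seteqP; split=> z [x]; first by case=> Ex _ xz; exists x.
move=> Ex xz; have [e|nx] := eqVneq x b; last by exists x => //; split=> //= /eqP; apply/negP.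
exists a => //=; apply: dvdz_trans xz; rewrite e; exact: ab.
Qed.
End LogDensity.

(** * Sets of primes with divergent reciprocal sum *)

Section Primes.
Variable R : realType.

(** For n prime to [S] in the sense of [free], multiplication by the new prime p changes nothing, so
    the multiples of p removed from p periods amount to one period. *)
Lemma mean_free_cons_prime (p Q : nat) (S : seq nat) : prime p -> (0 < Q)%N ->
  all (fun s => s %| Q)%N S -> all prime S -> p \notin S ->
  mean R (free (p :: S)) (p * Q) = (1 - p%:R^-1) * mean R (free S) Q.
Proof.
move=> pp Q0 SQ Sp pS; have p0 := prime_gt0 pp.
have pr : p%:R != 0 :> R by rewrite pnatr_eq0 -lt0n.
have hd m : free S (m * p)%N = free S m.
  apply: eq_in_all => s sS; congr (~~ _); have ps := allP Sp s sS.
  rewrite Euclid_dvdM // [(s %| p)%N]dvdn_prime2 // orbC.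
  by case: eqP => // e; rewrite -e sS in pS.
have e1 : \sum_(n < p * Q) (free (p :: S) n)%:R =
    \sum_(n < p * Q) (free S n)%:R - \sum_(n < Q) (free S n)%:R :> R.
  rewrite -[X in _ = _ - X](eq_bigr _ (fun (n : 'I_Q) _ => congr1 (fun b : bool => b%:R) (hd n))).
  rewrite mulnC !(big_block _ (fun n => (free _ n)%:R)) -sumrB; apply: eq_bigr => m _.
  rewrite [LHS](bigD1 (Ordinal p0)) // [X in _ = X - _](bigD1 (Ordinal p0)) //=.
  rewrite addn0 dvdn_mull //= add0r addrAC subrr add0r; apply: eq_bigr => i i0.
  rewrite dvdn_addr ?dvdn_mull // gtnNdvd ?ltn_ord //.
  by rewrite lt0n.
have := mean_mul R Q0 p0 (free_periodic SQ); rewrite /mean e1 natrM => h.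
rewrite mulrBl h mulrBl mul1r; congr (_ - _).
by rewrite invfM mulrCA.
Qed.

Lemma prod_primes_gt0 (S : seq nat) : all prime S -> (0 < \prod_(p <- S) p)%N.
Proof.
move=> /allP hS; rewrite big_seq; elim/big_ind: _ => // [x y|p /hS /prime_gt0 //].
by rewrite muln_gt0 => -> ->.
Qed.

Lemma dvdn_prod_seq (S : seq nat) : all (fun s => s %| \prod_(p <- S) p)%N S.
Proof. by apply/allP => s sS; rewrite (big_rem s) //= dvdn_mulr. Qed.

(** The induction rests on (1 - x) (1 + x + s) <= 1 + s for nonnegative x and s. *)
Lemma mean_free_primes (S : seq nat) : uniq S -> all prime S ->
  mean R (free S) (\prod_(p <- S) p)%N * (1 + \sum_(p <- S) p%:R^-1) <= 1.
Proof.
elim: S => [|p S IH] /=.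
  by rewrite !big_nil addr0 mulr1 mean_le1.
move=> /andP[pS uS] /andP[pp Sp]; rewrite !big_cons.
rewrite mean_free_cons_prime ?prod_primes_gt0 ?dvdn_prod_seq //.
have := IH uS Sp; set m := mean _ _ _; set s := \sum_(_ <- _) _ => h.
have s0 : 0 <= s by apply: sumr_ge0 => k _; rewrite invr_ge0.
have x0 : 0 <= p%:R^-1 :> R by rewrite invr_ge0.
have m0 : 0 <= m by exact: mean_ge0.
apply: le_trans h; move: (p%:R^-1) x0 => x x0.
rewrite -mulrA mulrCA ler_wpM2l //.
have := mulr_ge0 x0 s0; have := sqr_ge0 x; rewrite expr2; nra.
Qed.

Lemma almost_covering_primes (P : set nat) : P `<=` [set p | prime p] ->
  (forall V : R, exists S : seq nat,
     [/\ uniq S, forall p, p \in S -> P p & V < \sum_(p <- S) p%:R^-1]) ->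
  almost_covering R P.
Proof.
move=> hP div eps e0; have [S [uS SP hV]] := div eps^-1.
have Sp : all prime S by apply/allP => p /SP /hP.
exists S, (\prod_(p <- S) p)%N; split; rewrite ?prod_primes_gt0 ?dvdn_prod_seq //.
have := mean_free_primes uS Sp; set m := mean _ _ _ => h.
have s0 : 0 < 1 + \sum_(p <- S) (p%:R : R)^-1.
  by rewrite addr_gt0 // (lt_trans _ hV) // invr_gt0.
rewrite -ler_pdivlMr // div1r in h; apply: le_lt_trans h _.
rewrite invf_plt ?posrE //; apply: lt_trans hV _; lra.
Qed.

End Primes.

(** * Behrend quotients and the tautification *)

Section Tautification.
Variable R : realType.

Lemma almost_covering_split_seq (I : eqType) (s : seq I) (G : I -> set nat) (A : set nat) :
  (forall a, A a -> exists2 i, i \in s & exists2 b, G i b & (b %| a)%N) ->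
  almost_covering R A -> exists2 i, i \in s & almost_covering R (G i).
Proof.
elim: s A => [|i s IH] A cov hA.
  exfalso; apply: (@not_almost_covering_sub1 R 2 A) => // a /cov[i].
  by rewrite in_nil.
pose U := [set b | exists2 k, k \in s & G k b].
have [] := @almost_covering_split R A (G i) U _ hA.
- move=> a /cov[k]; rewrite inE => /orP[/eqP ->|ks] [b Gb ba]; first by left; exists b.
  by right; exists b => //; exists k.
- by exists i; rewrite ?mem_head.
move=> /IH[b [k ks Gb]|k ks hk]; first by exists k => //; exists b.
by exists k => //; rewrite inE ks orbT.
Qed.

Variables (e : nat -> nat) (A : nat -> set nat).
Let E : set nat := \bigcup_(i in [set i : nat | (1 <= i)%N]) [set e i].
Let B : set nat := \bigcup_(i in [set i : nat | (1 <= i)%N]) dilate (e i) (A i).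
Hypothesis e_gt0 : forall i, (1 <= i)%N -> (0 < e i)%N.
Hypothesis A_prime : forall i, (1 <= i)%N -> A i `<=` [set p | prime p].
Hypothesis A_behrend : forall i, (1 <= i)%N -> behrend R (A i).
Hypothesis E_taut : taut R E.

(** From c a = e_i p and g = gcd (e_i, c) it follows that e_i / g divides a. As g runs over the
    finitely many divisors of c, the quotients for some g are almost covering, and their dilate by g
    lies in [E]. *)
Lemma behrend_quotient_multiple (c : nat) : behrend_quotients R B c ->
  exists2 i, (1 <= i)%N & (e i %| c)%N.
Proof.
case=> c0 [D hD cDB]; apply: contrapT => no.
pose G (g : nat) := [set b | exists i, [/\ (1 <= i)%N, g = gcdn (e i) c & e i = (g * b)%N]].
have cov a : D a -> exists2 g, g \in divisors c & exists2 b, G g b & (b %| a)%N.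
  move=> Da; have [i i1 [p Ap epa]] : B (c * a)%N by apply: cDB; exists a.
  have ec : (e i %| c * a)%N by rewrite -epa dvdn_mulr.
  exists (gcdn (e i) c); first by rewrite -dvdn_divisors // dvdn_gcdr.
  have g0 : (0 < gcdn (e i) c)%N by rewrite gcdn_gt0 e_gt0.
  exists (e i %/ gcdn (e i) c)%N.
    by exists i; split=> //; rewrite mulnC divnK // dvdn_gcdl.
  have co : coprime (e i %/ gcdn (e i) c) (c %/ gcdn (e i) c).
    rewrite /coprime -(eqn_pmul2l g0) muln1 muln_gcdr ![(gcdn (e i) c * _)%N]mulnC.
    by rewrite !divnK // ?dvdn_gcdl ?dvdn_gcdr.
  rewrite -(Gauss_dvdr _ co) -(dvdn_pmul2l g0) mulnA ![(gcdn (e i) c * _)%N]mulnC.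
  by rewrite !divnK // ?dvdn_gcdl ?dvdn_gcdr.
have [g gc hG] := almost_covering_split_seq cov (behrend_almost_covering hD).
have g0 : (0 < g)%N by move: gc; rewrite -dvdn_divisors //; apply: dvdn_gt0.
apply: (taut_no_dilate E_taut g0 _ hG) => [b [i [i1 hg eb]]|_ [b [i [i1 hg eb]] <-]].
  (* A quotient 1 would mean that e_i = g divides c. *)
  rewrite /= ltn_neqAle; apply/andP; split.
    apply: contra_notN no => /eqP b1; exists i => //.
    by rewrite eb -b1 muln1 hg dvdn_gcdr.
  by have := e_gt0 i1; rewrite eb muln_gt0 => /andP[].
by exists i.
Qed.

(** Every e_i is a Behrend quotient, everything in [B] or among the quotients is a multiple of some
    e_i, and a taut set is primitive. *)
Lemma tautification_bigcup : tautification R B = E.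
Proof.
have quot i : (1 <= i)%N -> behrend_quotients R B (e i).
  move=> i1; split; first exact: e_gt0.
  by exists (A i); [exact: A_behrend|move=> _ [a Aa <-]; exists i => //; exists a].
have mult x : (B `|` behrend_quotients R B) x -> (0 < x)%N /\ exists2 i, (1 <= i)%N & (e i %| x)%N.
  case=> [[i i1 [a Aa <-]]|hx].
    split; last by exists i => //; rewrite dvdn_mulr.
    by rewrite muln_gt0 e_gt0 //= prime_gt0 //; apply: A_prime Aa.
  by split; [case: hx|exact: behrend_quotient_multiple].
apply/seteqP; split=> [x [hx hk]|_ [i i1 ->]].
  have [x0 [i i1 /dvdnP[k xk]]] := mult x hx.
  exists i => //=; have [k2|] := ltnP 1 k.
    by case: hk; exists k => //; exists (e i); [right; exact: quot|rewrite xk].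
  by case: k xk x0 => [|[|k]] // -> ; rewrite ?mul0n ?mul1n.
split; first by right; exact: quot.
case=> k k2 [y hy yk]; have [y0 [j j1 jy]] := mult y hy.
have ji : (e j %| e i)%N by rewrite -yk dvdn_mull.
have Ei : E (e i) by exists i.
have Ej : E (e j) by exists j.
have eji := taut_primitive E_taut Ej Ei ji.
have := dvdn_leq y0 jy; rewrite eji -yk leqNgt => /negP[].
by rewrite -{1}(mul1n y) ltn_pmul2r.
Qed.
End Tautification.

(** * Natural density of the multiples of the union *)

Definition prefix_seq (e : nat -> nat) (k : nat) : seq nat := [seq e i | i <- iota 1 k].
Definition prefix_prod (e : nat -> nat) (k : nat) : nat := \prod_(1 <= i < k.+1) e i.

Section Besicovitch.
Variables (R : realType) (e : nat -> nat) (A : nat -> set nat).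
Let B : set nat := \bigcup_(i in [set i : nat | (1 <= i)%N]) dilate (e i) (A i).
Local Notation S := (prefix_seq e).
Local Notation K := (prefix_prod e).
Hypothesis e_gt0 : forall i, (1 <= i)%N -> (0 < e i)%N.

Lemma prefix_prod_gt0 k : (0 < K k)%N.
Proof.
rewrite /prefix_prod big_nat; elim/big_ind: _ => // [x y|i /andP[i1 _]].
  by rewrite muln_gt0 => -> ->.
exact: e_gt0.
Qed.

Lemma prefix_prodS k : K k.+1 = (e k.+1 * K k)%N.
Proof. by rewrite /prefix_prod big_nat_recr //= mulnC. Qed.

Lemma prefix_prod_le j k : (j <= k)%N -> (K j <= K k)%N.
Proof.
move=> jk; rewrite -(subnK jk); elim: (k - j)%N => // i IH.
by rewrite addSn prefix_prodS (leq_trans IH) // leq_pmull // e_gt0.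
Qed.

Lemma prefix_seq_dvd k : all (fun s => s %| K k)%N (S k).
Proof.
apply/allP => _ /mapP[i hi ->]; rewrite mem_iota add1n in hi.
by rewrite /prefix_prod (bigD1_seq i) ?iota_uniq ?mem_index_iota //= dvdn_mulr.
Qed.

Lemma free_prefixP k n :
  reflect (exists2 j, (1 <= j <= k)%N & (e j %| n)%N) (~~ free (S k) n).
Proof.
rewrite -has_predC; apply: (iffP hasP) => [[_ /mapP[j hj ->]]|[j hj ejn]].
  by rewrite mem_iota add1n ltnS in hj; rewrite /= negbK => ejn; exists j.
exists (e j); last by rewrite /= negbK.
by apply/mapP; exists j => //; rewrite mem_iota add1n ltnS.
Qed.

Definition prefix_mean (k : nat) : R := mean R (free (S k)) (K k).

Lemma free_prefixS k n : free (S k.+1) n = free (S k) n && ~~ (e k.+1 %| n)%N.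
Proof. by rewrite /prefix_seq -(addn1 k) iotaD map_cat /free all_cat /= andbT addnC. Qed.

(** As differences of consecutive prefix means, these densities have telescoping sums. *)
Lemma mean_first_divisor k :
  mean R (fun n => free (S k) n && (e k.+1 %| n)%N) (K k.+1)
    = prefix_mean k - prefix_mean k.+1.
Proof.
rewrite /prefix_mean -(mean_mul R (prefix_prod_gt0 k) (e_gt0 (isT : 0 < k.+1)%N)
  (free_periodic (prefix_seq_dvd k))) -prefix_prodS.
rewrite /mean -mulrBl -sumrB; congr (_ / _); apply: eq_bigr => n _.
by rewrite free_prefixS; case: (free _ _) => /=; case: (_ %| _)%N; rewrite ?subrr ?subr0.
Qed.

Lemma prefix_mean_anti k : prefix_mean k.+1 <= prefix_mean k.
Proof. by rewrite -subr_ge0 -mean_first_divisor mean_ge0. Qed.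

(* Starting the count at [K k.+1] absorbs the boundary term of a full period. *)
Lemma nat_count_first_divisor k n :
  nat_count R (fun x => [&& free (S k) x, (e k.+1 %| x)%N & (K k.+1 <= x)%N]) n
    <= 2 * n%:R * (prefix_mean k - prefix_mean k.+1).
Proof.
have m0 : 0 <= prefix_mean k - prefix_mean k.+1 by rewrite subr_ge0 prefix_mean_anti.
have [nK|Kn] := ltnP n (K k.+1).
  rewrite [leLHS](_ : _ = 0) ?mulr_ge0 //.
  rewrite /nat_count big_nat big1 // => x /andP[_ xn].
  by rewrite [(K _ <= _)%N]leqNgt (leq_ltn_trans _ nK) ?andbF // -ltnS.
have per : periodic (K k.+1) (fun x => free (S k) x && (e k.+1 %| x)%N).
  move=> x; rewrite dvdn_addl; last by rewrite prefix_prodS dvdn_mulr.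
  have -> : (x + K k.+1 = e k.+1 * K k + x)%N by rewrite prefix_prodS addnC.
  by rewrite (periodicM (free_periodic (prefix_seq_dvd k))).
apply: (@le_trans _ _ (nat_count R (fun x => free (S k) x && (e k.+1 %| x)%N) n)).
  apply: ler_sum => x _; rewrite ler_nat; case: (free _ _) => //=.
  by case: (_ %| _)%N => //=; exact: leq_b1.
apply: le_trans (nat_count_periodic_le R n (prefix_prod_gt0 _) per) _.
rewrite mean_first_divisor mulrC ler_wpM2r // -natrM ler_nat.
by rewrite mul2n -addnn leq_add2r.
Qed.

Lemma prefix_mean_inf : exists m : R, (forall k, m <= prefix_mean k) /\
  forall eps, 0 < eps -> exists k, prefix_mean k < m + eps.
Proof.
pose X := [set prefix_mean k | k in [set: nat]].
have hX : has_inf X.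
  by split; [exists (prefix_mean 0), 0%N|exists 0 => _ [k _ <-]; exact: mean_ge0].
exists (inf X); split=> [k|eps e0]; first by apply: inf_lbound; [case: hX|exists k].
by have [_ [k _ <-] h] := inf_adherent e0 hX; exists k.
Qed.

Hypothesis A_covering : forall i, (1 <= i)%N -> almost_covering R (A i).
Hypothesis A_large : forall i, (1 <= i)%N -> A i `<=` [set n | (K i <= n)%N].

(** One index is chosen for each x <= n, and [J] bounds them all. The e_i may repeat and the [K i]
    need not tend to infinity, so [A_large] alone does not bound the index. *)
Lemma multiples_index_bound n : exists J : nat, forall x : nat, (0 < x <= n)%N ->
  x%:Z \in multiples B ->
  exists2 i, (1 <= i <= J)%N & exists2 a, A i a & (e i * a %| x)%N.
Proof.
elim: n => [|n [J hJ]]; first by exists 0%N => -[].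
have [/mem_multiples[_ [i i1 [a Aa <-]] eax]|hn] := boolP (n.+1%:Z \in multiples B); last first.
  exists J => x /andP[x0]; rewrite leq_eqVlt ltnS => /orP[/eqP ->|xn].
    by rewrite (negbTE hn).
  by apply: hJ; rewrite x0.
exists (maxn i J) => x /andP[x0]; rewrite leq_eqVlt ltnS => /orP[/eqP -> _|xn hx].
  by exists i; [rewrite i1 leq_maxl|exists a].
have xn0 : (0 < x <= n)%N by rewrite x0.
by case: (hJ x xn0 hx) => l /andP[l1 lJ] h; exists l => //; rewrite l1 leq_max lJ orbT.
Qed.

(** A multiple of [B] is classified by the least l with e_l dividing it: those with l <= k are in
    the first count, and the classes with l > k have telescoping bounds. *)
Lemma nat_count_multiples_le (m : R) k n : (forall k, m <= prefix_mean k) ->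
  nat_count R (fun x => x%:Z \in multiples B) n
    <= nat_count R (fun x => ~~ free (S k) x) n + 2 * n%:R * (prefix_mean k - m).
Proof.
move=> hm; have [J hJ] := multiples_index_bound n.
pose t j x := [&& free (S j) x, (e j.+1 %| x)%N & (K j.+1 <= x)%N].
apply: (@le_trans _ _ (nat_count R (fun x => ~~ free (S k) x) n
    + \sum_(k <= j < maxn k J) nat_count R (t j) n)); last first.
  rewrite lerD2l; apply: (@le_trans _ _ (\sum_(k <= j < maxn k J)
     2 * n%:R * (prefix_mean j - prefix_mean j.+1))).
    by apply: ler_sum => j _; exact: nat_count_first_divisor.
  rewrite -mulr_sumr ler_wpM2l ?mulr_ge0 //.
  rewrite (eq_bigr (fun j => - (prefix_mean j.+1 - prefix_mean j))) => [|j _];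
    last by rewrite opprB.
  by rewrite sumrN telescope_sumr ?leq_maxl // opprB lerD2l lerN2.
rewrite /nat_count exchange_big -big_split /= big_nat [leRHS]big_nat; apply: ler_sum => x.
rewrite ltnS => hx; have t0 : 0 <= \sum_(k <= j < maxn k J) (t j x)%:R :> R by exact: sumr_ge0.
case: (boolP (x%:Z \in _)) => [hB|_]; last by rewrite addr_ge0.
case: (boolP (free (S k) x)) => [fk|_]; last by rewrite /= lerDl.
have [i /andP[i1 iJ] [a Aa eax]] := hJ x hx hB.
have [x0 _] := andP hx.
have ex : exists j, (0 < j)%N && (e j %| x)%N.
  by exists i; rewrite i1 (dvdn_trans _ eax) // dvdn_mulr.
have [l /andP[l0 el] minl] := ex_minnP ex.
have li : (l <= i)%N by apply: minl; rewrite i1 (dvdn_trans _ eax) // dvdn_mulr.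
have kl : (k < l)%N.
  rewrite ltnNge; apply/negP => lk; move: fk; apply/negP/free_prefixP.
  by exists l; rewrite ?l0.
have fl : free (S l.-1) x.
  apply: contraT => /free_prefixP[j /andP[j1 jl] ej].
  have := minl j; rewrite j1 ej => /(_ isT) lj.
  by move: (leq_trans lj jl); rewrite leqNgt ltn_predL l0.
(* Minimality gives l <= i, whence K l <= K i <= a <= x. *)
have Kx : (K l <= x)%N.
  apply: leq_trans (prefix_prod_le li) _; apply: leq_trans (A_large i1 Aa) _.
  by apply: leq_trans (dvdn_leq x0 eax); rewrite leq_pmull // e_gt0.
have lin : l.-1 \in index_iota k (maxn k J).
  by rewrite mem_index_iota -ltnS prednK // kl leq_max (leq_trans li iJ) orbT.
rewrite add0r (bigD1_seq l.-1 lin) ?iota_uniq //=.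
by rewrite {1}/t prednK // fl el Kx lerDl sumr_ge0.
Qed.

(** A multiple x of e_j that is missed by [B] has x / e_j outside the multiples of [A j], and these
    quotients are rare. *)
Lemma nat_count_multiples_ge k n :
  nat_count R (fun x => ~~ free (S k) x) n
    <= nat_count R (fun x => x%:Z \in multiples B) n
       + \sum_(1 <= j < k.+1) nat_count R (fun x => x%:Z \notin multiples (A j)) n.
Proof.
apply: (@le_trans _ _ (nat_count R (fun x => x%:Z \in multiples B) n + \sum_(1 <= j < k.+1)
   nat_count R (fun x => (e j %| x)%N && ((x %/ e j)%N%:Z \notin multiples (A j))) n)); last first.
  rewrite lerD2l big_nat [leRHS]big_nat; apply: ler_sum => j /andP[j1 _].
  exact: (nat_count_dilate R (fun x => x%:Z \notin multiples (A j)) n (e_gt0 j1)).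
rewrite /nat_count exchange_big -big_split /=; apply: ler_sum => x _.
case: (boolP (free (S k) x)) => [_|/free_prefixP[j jk ejx]] /=.
  by rewrite addr_ge0 // sumr_ge0.
have [hB|hB] := boolP (x%:Z \in multiples B); first by rewrite lerDl sumr_ge0.
rewrite add0r (bigD1_seq j) ?iota_uniq ?mem_index_iota //= ejx /=.
suff -> : (x %/ e j)%N%:Z \notin multiples (A j) by rewrite lerDl sumr_ge0.
have /andP[j1 _] := jk.
apply: contra hB => /mem_multiples[a Aa ax]; apply/mem_multiples.
exists (e j * a)%N; first by exists j => //; exists a.
by rewrite -(divnK ejx) mulnC dvdn_pmul2r // e_gt0.
Qed.

Lemma sum_covering_bound k (eps : R) : 0 < eps -> exists C : R, forall n,
  \sum_(1 <= j < k.+1) nat_count R (fun x => x%:Z \notin multiples (A j)) n <= C + eps * n%:R.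
Proof.
elim: k eps => [|k IH] eps e0.
  by exists 0 => n; rewrite big_geq // add0r mulr_ge0 // ltW.
have e20 : 0 < eps / 2 by lra.
have [C1 h1] := IH _ e20.
have [C2 h2] := almost_covering_nat_count (A_covering (isT : (1 <= k.+1)%N)) e20.
exists (C1 + C2) => n; rewrite big_nat_recr //=.
by have := h1 n; have := h2 n; lra.
Qed.

Lemma besicovitch_bigcup : besicovitch R B.
Proof.
have [m [m_le m_inf]] := prefix_mean_inf.
suff h : natural_average R (multiples B) n @[n --> \oo] --> 1 - m by apply: cvgP h.
rewrite (_ : natural_average R (multiples B) =
  (fun n => nat_count R (fun k => k%:Z \in multiples B) n / n%:R)); last first.
  by apply/funext => n; rewrite natural_averageE.
apply: cvg_quotient => [M|eps e0].
  exists (Num.truncn M).+1 => n hn; apply: ltW; apply: lt_le_trans (truncnS_gt _) _.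
  by rewrite ler_nat.
have e20 : 0 < eps / 2 by lra.
have [k hk] := m_inf _ e20; have mk := m_le k.
have [C hC] := sum_covering_bound k e20.
have Kper := free_periodic (prefix_seq_dvd k).
(* [C] accounts for the integers missed by the multiples of A_1, ..., A_k, and 1 + K k for
   incomplete periods. *)
exists (`|C| + 1 + (K k)%:R) => n _.
have compl : nat_count R (free (S k)) n + nat_count R (fun x => ~~ free (S k) x) n = n%:R.
  rewrite -big_split /= (eq_bigr (fun=> 1)) => [|x _];
    last by case: (free _ _); rewrite ?addr0 ?add0r.
  by rewrite big_add1 big_mkord sumr_const card_ord.
have u1 := nat_count_multiples_le k n m_le.
have l1 := nat_count_multiples_ge k n.
have u2 := nat_count_periodic_ge R n (prefix_prod_gt0 k) Kper.
have l2 := nat_count_periodic_le R n (prefix_prod_gt0 k) Kper.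
have l3 := hC n; have n0 : 0 <= n%:R :> R by [].
have c1 := ler_norm C.
have pK : prefix_mean k * (K k)%:R <= (K k)%:R.
  by rewrite -[leRHS]mul1r ler_wpM2r // mean_le1.
rewrite -/(prefix_mean k) natrD mulrDr in u2 l2.
have d1 : prefix_mean k * n%:R - m * n%:R <= eps * n%:R / 2.
  by rewrite -mulrBl mulrAC ler_wpM2r //; lra.
have d0 : m * n%:R <= prefix_mean k * n%:R by rewrite ler_wpM2r.
have u1' : 2 * n%:R * (prefix_mean k - m) = 2 * (prefix_mean k * n%:R) - 2 * (m * n%:R) by ring.
have l3' : eps / 2 * n%:R = eps * n%:R / 2 by ring.
rewrite u1' in u1; rewrite l3' in l3; rewrite mulrBl mul1r.
move: (m * n%:R) (prefix_mean k * n%:R) (eps * n%:R) (prefix_mean k * (K k)%:R)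
  u1 l1 u2 l2 l3 d1 d0 pK compl => mn pn en pk u1 l1 u2 l2 l3 d1 d0 pK compl.
by have := normr_ge0 C; rewrite ler_norml => C0; apply/andP; split; lra.
Qed.
End Besicovitch.

(** * Behrend sets of primes in the progressions, and the theorem *)

Lemma progression_primes_behrend (R : realType) (i K : nat) : (1 <= i)%N ->
  behrend R (progression_primes i `&` [set n : nat | (K <= n)%N]).
Proof.
case: i => // j _; apply: almost_covering_behrend => [p [[/prime_gt1 //]]|].
apply: almost_covering_primes => [p [[]] //|V].
(* Discarding the primes below [K] costs at most [K], since each reciprocal is at most 1. *)
have [n hn] := sum_inv_progression_unbounded j (V + K%:R).
pose in_class p := prime p && (p == 2 ^ j.+1 + 1 %[mod 2 ^ j.+2])%N.
exists [seq p <- index_iota 0 n | in_class p && (K <= p)%N]; split.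
- by rewrite filter_uniq // iota_uniq.
- by move=> p; rewrite mem_filter => /andP[/andP[/andP[pp /eqP hp] Kp] _]; split.
rewrite -(ltrD2r K%:R); apply: lt_le_trans hn _.
rewrite big_filter -(big_mkord in_class (fun p => (p%:R : R)^-1)).
rewrite (bigID (fun p => K <= p)%N) /= lerD2l big_mkord big_mkcond.
apply: (@le_trans _ _ (\sum_(p < n) (p < K)%N%:R)).
  apply: ler_sum => p _; rewrite -ltnNge; case: (p < K)%N; rewrite ?andbT ?andbF //.
  case: ifP => // /andP[/prime_gt0 p0 _].
  by rewrite invf_le1 ?ltr0n // ler1n.
by rewrite -natr_sum sum_lt_minn ler_nat geq_minr.
Qed.

Theorem corollary1p14 (R : realType) (e : nat -> nat)
    (he : forall i : nat, (1 <= i)%N -> (0 < e i)%N)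
    (hE : taut R (\bigcup_(i in [set i : nat | (1 <= i)%N]) [set e i])) :
  exists K : nat -> nat,
    [/\ forall i : nat, (1 <= i)%N -> (0 < K i)%N,
        forall A : nat -> set nat,
          (forall i : nat, (1 <= i)%N ->
             behrend R (A i) /\
             A i `<=` progression_primes i `&` [set n : nat | (K i <= n)%N]) ->
          let B := \bigcup_(i in [set i : nat | (1 <= i)%N]) dilate (e i) (A i) in
          besicovitch R B /\
          tautification R B =
            \bigcup_(i in [set i : nat | (1 <= i)%N]) [set e i]
      & forall i : nat, (1 <= i)%N ->
          behrend R (progression_primes i `&` [set n : nat | (K i <= n)%N])].
Proof.
exists (prefix_prod e); split=> [i _|A hA B|i i1].
- exact: prefix_prod_gt0.
- split.
    apply: besicovitch_bigcup => // i i1; first by case: (hA i i1) => /behrend_almost_covering.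
    by move=> a Aa; have [_ /(_ a Aa)[]] := hA i i1.
  apply: tautification_bigcup => // i i1; last by case: (hA i i1).
  by move=> a Aa; have [_ /(_ a Aa)[[]]] := hA i i1.
- exact: progression_primes_behrend.
Qed.
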